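(* Let $X$ be a Banach space. If there is a map $f\colon X\to Y$ into a superstable Banach space $Y$ which is uniformly continuous and almost uncollapsed, then the closed unit ball $B_X$ uniformly embeds into a superstable Banach space.
   Context: A map $f\colon X\to Y$ between Banach spaces is almost uncollapsed if there is $t>0$ with $\inf\{\|f(x)-f(y)\|:\|x-y\|=t\}>0$. A uniform embedding is an injective uniformly continuous map whose inverse (on its image) is uniformly continuous. A Banach space is stable if for all bounded sequences $(x_i),(y_j)$ and nonprincipal ultrafilters $\mathcal U,\mathcal V$ on $\mathbb N$, $\lim_{i,\mathcal U}\lim_{j,\mathcal V}\|x_i-y_j\|=\lim_{j,\mathcal V}\lim_{i,\mathcal U}\|x_i-y_j\|$; it is superstable if every Banach space finitely representable in it is stable. *)

(* Defs.v *)
From Stdlib Require Import Reals.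
Open Scope R_scope.

Record Banach : Type := {
  vec :> Type;
  vzero : vec;
  vadd : vec -> vec -> vec;
  vopp : vec -> vec;
  vscal : R -> vec -> vec;
  vnorm : vec -> R;
  vadd_assoc : forall x y z, vadd x (vadd y z) = vadd (vadd x y) z;
  vadd_comm : forall x y, vadd x y = vadd y x;
  vadd_0 : forall x, vadd x vzero = x;
  vadd_opp : forall x, vadd x (vopp x) = vzero;
  vscal_1 : forall x, vscal 1 x = x;
  vscal_assoc : forall a b x, vscal a (vscal b x) = vscal (a * b) x;
  vscal_distr_v : forall a x y, vscal a (vadd x y) = vadd (vscal a x) (vscal a y);
  vscal_distr_s : forall a b x, vscal (a + b) x = vadd (vscal a x) (vscal b x);
  vnorm_eq0 : forall x, vnorm x = 0 -> x = vzero;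
  vnorm_scal : forall a x, vnorm (vscal a x) = Rabs a * vnorm x;
  vnorm_triangle : forall x y, vnorm (vadd x y) <= vnorm x + vnorm y;
  vcomplete : forall u : nat -> vec,
    (forall eps, 0 < eps -> exists N, forall m n, (N <= m)%nat -> (N <= n)%nat ->
        vnorm (vadd (u m) (vopp (u n))) < eps) ->
    exists l, forall eps, 0 < eps -> exists N, forall n, (N <= n)%nat ->
        vnorm (vadd (u n) (vopp l)) < eps
}.

Arguments vzero {_}. Arguments vadd {_}. Arguments vopp {_}.
Arguments vscal {_}. Arguments vnorm {_}.

Definition dist {X : Banach} (x y : X) : R := vnorm (vadd x (vopp y)).

Definition ultrafilter (U : (nat -> Prop) -> Prop) : Prop :=
  U (fun _ => True) /\ ~ U (fun _ => False) /\
  (forall A B : nat -> Prop, U A -> (forall n, A n -> B n) -> U B) /\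
  (forall A B : nat -> Prop, U A -> U B -> U (fun n => A n /\ B n)) /\
  (forall A : nat -> Prop, U A \/ U (fun n => ~ A n)).

Definition nonprincipal (U : (nat -> Prop) -> Prop) : Prop :=
  forall k : nat, ~ U (fun n => n = k).

Definition ulim (U : (nat -> Prop) -> Prop) (a : nat -> R) (L : R) : Prop :=
  forall eps, 0 < eps -> U (fun i => Rabs (a i - L) < eps).

Definition bounded_seq {X : Banach} (x : nat -> X) : Prop :=
  exists M, forall i, vnorm (x i) <= M.

(* Stability: lim_{i,U} lim_{j,V} ||x_i - y_j|| = lim_{j,V} lim_{i,U} ||x_i - y_j||.
   (Limits along ultrafilters of bounded real sequences exist and are unique;
   we phrase equality of the iterated limits relationally.) *)
Definition stable (X : Banach) : Prop :=
  forall (x y : nat -> X) (U V : (nat -> Prop) -> Prop),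
    bounded_seq x -> bounded_seq y ->
    ultrafilter U -> nonprincipal U -> ultrafilter V -> nonprincipal V ->
    forall (l : nat -> R) (L : R) (m : nat -> R) (M : R),
      (forall i, ulim V (fun j => dist (x i) (y j)) (l i)) -> ulim U l L ->
      (forall j, ulim U (fun i => dist (x i) (y j)) (m j)) -> ulim V m M ->
      L = M.

Fixpoint lincomb {X : Banach} (a : nat -> R) (z : nat -> X) (n : nat) : X :=
  match n with
  | O => vzero
  | S k => vadd (lincomb a z k) (vscal (a k) (z k))
  end.

(* Z is finitely representable in Y: every finite-dimensional subspace
   span(z_0..z_{n-1}) of Z maps (1+eps)-isomorphically into Y. *)
Definition fin_rep (Z Y : Banach) : Prop :=
  forall (n : nat) (z : nat -> Z) (eps : R), 0 < eps ->
    exists y : nat -> Y, forall a : nat -> R,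
      (1 - eps) * vnorm (lincomb a z n) <= vnorm (lincomb a y n) /\
      vnorm (lincomb a y n) <= (1 + eps) * vnorm (lincomb a z n).

Definition superstable (Y : Banach) : Prop :=
  forall Z : Banach, fin_rep Z Y -> stable Z.

Definition unif_cont {X Y : Banach} (f : X -> Y) : Prop :=
  forall eps, 0 < eps -> exists delta, 0 < delta /\
    forall x y, dist x y < delta -> dist (f x) (f y) < eps.

Definition almost_uncollapsed {X Y : Banach} (f : X -> Y) : Prop :=
  exists t, 0 < t /\ exists c, 0 < c /\
    forall x y, dist x y = t -> c <= dist (f x) (f y).

Definition in_ball {X : Banach} (x : X) : Prop := vnorm x <= 1.

Definition unif_embeds_ball {X Z : Banach} (g : X -> Z) : Prop :=
  (forall x y, in_ball x -> in_ball y -> g x = g y -> x = y) /\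
  (forall eps, 0 < eps -> exists delta, 0 < delta /\
    forall x y, in_ball x -> in_ball y -> dist x y < delta -> dist (g x) (g y) < eps) /\
  (forall eps, 0 < eps -> exists delta, 0 < delta /\
    forall x y, in_ball x -> in_ball y -> dist (g x) (g y) < delta -> dist x y < eps).

(* Main.v *)
(**
  For a small [r > 0], map [x] to the sequence with
  terms [4^-n (f (n r x) - f 0)] in [l1(Y)].  Since [f] has at most linear growth this is uniformly
  continuous on the unit ball; two points at distance [s] are separated by the coordinate [n]
  with [n r s] close to the distance [t] at which [f] does not collapse.

  That [l1(Y)] is superstable comes down to the absence of long ladders.  The ultrapowers of a
  superstable [Y] are stable, so that the trees of distances shattered by its unit
  ball have bounded height (Hodges' argument).  A bound on exponential moments along dyadic
  trees, as for sequential Rademacher complexity, turns this into a statement linear in the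
  kernel: for all bounded [x_i], [y_j], the mean of [|x_i - y_j| - |x_j - y_i|] over a random
  pair [i < j], drawn from the two halves of a dyadic block of random scale, is small.  Being
  linear, it can be summed over the coordinates of an [l1]-sum.  The coordinates are made bounded
  by the subsequence splitting principle: along a subsequence, the parts exceeding a fixed
  integrable function are almost disjoint, and they do not contribute to the kernel
  [|x - y| - |x| - |y|], which is at most [2 min (|x|, |y|)].
*)

From Stdlib Require Import Reals Lra Lia List Arith.
From Stdlib Require Import ClassicalEpsilon FunctionalExtensionality.
From Stdlib Require Import PropExtensionality ProofIrrelevance.
Require Import Defs.
Open Scope R_scope.

(** A ladder in an l1-sum need not leave a ladder in any coordinate: its gap may be spread over
    coordinates whose number is not controlled, and a Ramsey argument for each of them would depend
    on that number. What survives summation is an estimate linear in the kernel, with a depth [d]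
    that depends only on [Y] and on the accuracy. A single scale may well carry an asymmetry, since
    short ladders exist in [Y]; but the total over [d] scales can be made smaller than any given
    multiple of [d], whereas a ladder in the sum contributes its gap at every scale. The smallness
    comes from the rank: for trees of bounded rank, the exponential moment with parameter [lam] is
    polynomial in [d] up to a factor whose exponent per level is quadratic in [lam], apart from a
    discretisation error. Its logarithm divided by [lam] is therefore a small multiple of [d]. A
    space finitely representable in l1(Y) enters through its finite ladders only. All limits are
    taken along the ultrafilter [U] given in the stability statement to be proved for that space. *)

Lemma Rabs_le_inv a b : Rabs a <= b -> - b <= a <= b.
Proof. pose proof (Rle_abs a). pose proof (Rle_abs (- a)). rewrite Rabs_Ropp in *. lra. Qed.

Lemma Rdiv_nonneg a b : 0 <= a -> 0 < b -> 0 <= a / b.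
Proof. intros Ha Hb. apply Rmult_le_pos; [exact Ha|]. left. now apply Rinv_0_lt_compat. Qed.

(** * Finite sums *)

Fixpoint rsum (f : nat -> R) (n : nat) : R :=
  match n with O => 0 | S k => rsum f k + f k end.

Lemma rsum_ext f g n : (forall i, (i < n)%nat -> f i = g i) -> rsum f n = rsum g n.
Proof.
  induction n as [|n IH]; intros H; simpl; [reflexivity|].
  rewrite IH, H by auto. reflexivity.
Qed.

Lemma rsum_le f g n : (forall i, (i < n)%nat -> f i <= g i) -> rsum f n <= rsum g n.
Proof.
  induction n as [|n IH]; intros H; simpl; [lra|].
  pose proof (H n (Nat.lt_succ_diag_r n)).
  specialize (IH (fun i Hi => H i (Nat.lt_lt_succ_r _ _ Hi))).
  lra.
Qed.

Lemma rsum_zero n : rsum (fun _ => 0) n = 0.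
Proof. induction n as [|n IH]; simpl; lra. Qed.

Lemma rsum_pos f n : (forall i, (i < n)%nat -> 0 <= f i) -> 0 <= rsum f n.
Proof. intros H. rewrite <- (rsum_zero n). now apply rsum_le. Qed.

Lemma rsum_plus f g n : rsum (fun i => f i + g i) n = rsum f n + rsum g n.
Proof. induction n as [|n IH]; simpl; lra. Qed.

Lemma rsum_scal c f n : rsum (fun i => c * f i) n = c * rsum f n.
Proof. induction n as [|n IH]; simpl; [ring|]. rewrite IH. ring. Qed.

Lemma rsum_minus f g n : rsum (fun i => f i - g i) n = rsum f n - rsum g n.
Proof. induction n as [|n IH]; simpl; lra. Qed.

Lemma rsum_term f n k : (forall i, (i < n)%nat -> 0 <= f i) -> (k < n)%nat -> f k <= rsum f n.
Proof.
  induction n as [|n IH]; intros H Hk; [lia|]. simpl.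
  destruct (Nat.eq_dec k n) as [->|Hne].
  - pose proof (rsum_pos f n (fun i Hi => H i (Nat.lt_lt_succ_r _ _ Hi))). lra.
  - specialize (IH (fun i Hi => H i (Nat.lt_lt_succ_r _ _ Hi)) ltac:(lia)).
    pose proof (H n (Nat.lt_succ_diag_r n)). lra.
Qed.

Lemma rsum_mono f n m : (forall i, 0 <= f i) -> (n <= m)%nat -> rsum f n <= rsum f m.
Proof.
  intros H Hnm. induction Hnm as [|m _ IH]; simpl; [lra|]. specialize (H m). lra.
Qed.

(** * Vector identities *)

Lemma vadd_0_l {X : Banach} (x : X) : vadd vzero x = x.
Proof. rewrite vadd_comm. apply vadd_0. Qed.

Lemma vadd_cancel {X : Banach} (x y z : X) : vadd x z = vadd y z -> x = y.
Proof.
  intros H.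
  rewrite <- (vadd_0 _ x), <- (vadd_0 _ y), <- (vadd_opp _ z).
  rewrite !vadd_assoc. now rewrite H.
Qed.

Lemma vscal_0_l {X : Banach} (x : X) : vscal 0 x = vzero.
Proof.
  apply (vadd_cancel _ _ (vscal 0 x)).
  rewrite <- vscal_distr_s, vadd_0_l. now rewrite Rplus_0_r.
Qed.

Lemma vscal_0_r {X : Banach} (a : R) : vscal a (vzero : X) = vzero.
Proof. rewrite <- (vscal_0_l vzero), vscal_assoc. now rewrite Rmult_0_r. Qed.

Lemma vopp_scal {X : Banach} (x : X) : vopp x = vscal (-1) x.
Proof.
  apply (vadd_cancel _ _ x).
  rewrite (vadd_comm _ (vopp x)), vadd_opp.
  rewrite <- (vscal_1 _ x) at 2. rewrite <- vscal_distr_s.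
  replace (-1 + 1) with 0 by lra. now rewrite vscal_0_l.
Qed.

Lemma vadd_swap {X : Banach} (a b c d : X) :
  vadd (vadd a b) (vadd c d) = vadd (vadd a c) (vadd b d).
Proof.
  rewrite <- !vadd_assoc. f_equal. rewrite !vadd_assoc. f_equal. apply vadd_comm.
Qed.

Lemma lincomb_ext {X : Banach} (a b : nat -> R) (z w : nat -> X) n :
  (forall i, (i < n)%nat -> a i = b i) -> (forall i, (i < n)%nat -> z i = w i) ->
  lincomb a z n = lincomb b w n.
Proof.
  induction n as [|n IH]; intros Ha Hz; simpl; [reflexivity|].
  rewrite IH, Ha, Hz by auto. reflexivity.
Qed.

Lemma lincomb_add {X : Banach} (a b : nat -> R) (z : nat -> X) n :
  lincomb (fun i => a i + b i) z n = vadd (lincomb a z n) (lincomb b z n).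
Proof.
  induction n as [|n IH]; simpl; [now rewrite vadd_0|].
  rewrite IH, vscal_distr_s. apply vadd_swap.
Qed.

Lemma lincomb_scal {X : Banach} c (a : nat -> R) (z : nat -> X) n :
  lincomb (fun i => c * a i) z n = vscal c (lincomb a z n).
Proof.
  induction n as [|n IH]; simpl; [now rewrite vscal_0_r|].
  now rewrite IH, vscal_distr_v, vscal_assoc.
Qed.

Lemma lincomb_zero {X : Banach} (z : nat -> X) n : lincomb (fun _ => 0) z n = vzero.
Proof.
  induction n as [|n IH]; simpl; [reflexivity|].
  now rewrite IH, vscal_0_l, vadd_0.
Qed.

Lemma lincomb_single {X : Banach} (z : nat -> X) k n : (k < n)%nat ->
  lincomb (fun i => if Nat.eqb i k then 1 else 0) z n = z k.
Proof.
  induction n as [|n IH]; intros Hk; simpl; [lia|].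
  destruct (Nat.eqb_spec n k) as [->|Hne].
  - rewrite vscal_1.
    rewrite (lincomb_ext _ (fun _ => 0) z z), lincomb_zero, vadd_0_l; auto.
    intros i Hi. destruct (Nat.eqb_spec i k); [lia|reflexivity].
  - rewrite vscal_0_l, vadd_0. apply IH. lia.
Qed.

(* Expressions in the vector space language.  Two of them agree in every space
   as soon as their coefficients agree, which [vec] below leaves to [ring] or [field]. *)
Inductive vexpr : Type :=
| VVar (n : nat) | VZero | VAdd (e f : vexpr) | VOpp (e : vexpr) | VScal (a : R) (e : vexpr).

Fixpoint veval {X : Banach} (env : list X) (e : vexpr) : X :=
  match e with
  | VVar n => nth n env vzero
  | VZero => vzero
  | VAdd e f => vadd (veval env e) (veval env f)
  | VOpp e => vopp (veval env e)
  | VScal a e => vscal a (veval env e)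
  end.

Fixpoint vcoef (e : vexpr) (i : nat) : R :=
  match e with
  | VVar n => if Nat.eqb i n then 1 else 0
  | VZero => 0
  | VAdd e f => vcoef e i + vcoef f i
  | VOpp e => (-1) * vcoef e i
  | VScal a e => a * vcoef e i
  end.

Fixpoint vscoped (n : nat) (e : vexpr) : bool :=
  match e with
  | VVar k => Nat.ltb k n
  | VZero => true
  | VAdd e f => andb (vscoped n e) (vscoped n f)
  | VOpp e => vscoped n e
  | VScal _ e => vscoped n e
  end.

Fixpoint vsame (n : nat) (e f : vexpr) : Prop :=
  match n with
  | O => True
  | S k => vcoef e k = vcoef f k /\ vsame k e f
  end.

Lemma veval_lincomb {X : Banach} (env : list X) n e : vscoped n e = true ->
  veval env e = lincomb (vcoef e) (fun i => nth i env vzero) n.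
Proof.
  induction e as [k| |e IHe f IHf|e IHe|a e IHe]; simpl; intros H.
  - apply Nat.ltb_lt in H.
    symmetry. exact (lincomb_single (fun i => nth i env vzero) k n H).
  - symmetry. apply lincomb_zero.
  - apply Bool.andb_true_iff in H. destruct H as [H1 H2].
    rewrite lincomb_add. now rewrite IHe, IHf.
  - rewrite lincomb_scal, vopp_scal. now rewrite IHe.
  - rewrite lincomb_scal. now rewrite IHe.
Qed.

Lemma veval_eq {X : Banach} (env : list X) n e f :
  vscoped n e = true -> vscoped n f = true -> vsame n e f -> veval env e = veval env f.
Proof.
  intros He Hf H. rewrite (veval_lincomb env n e He), (veval_lincomb env n f Hf).
  apply lincomb_ext; [|reflexivity].
  clear He Hf. induction n as [|n IH]; intros i Hi; [lia|].
  destruct H as [H1 H2].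
  destruct (Nat.eq_dec i n) as [->|Hne]; [exact H1|]. apply IH; [exact H2|lia].
Qed.

Ltac vmem x l :=
  match l with
  | nil => constr:(false)
  | cons x _ => constr:(true)
  | cons _ ?t => vmem x t
  end.
Ltac vcollect l t :=
  match t with
  | vadd ?a ?b => let l1 := vcollect l a in vcollect l1 b
  | vopp ?a => vcollect l a
  | vscal _ ?a => vcollect l a
  | vzero => l
  | ?x => match vmem x l with true => l | false => constr:(cons x l) end
  end.
Ltac vindex x l :=
  match l with
  | cons x _ => constr:(O)
  | cons _ ?t => let n := vindex x t in constr:(S n)
  end.
Ltac vreify l t :=
  match t with
  | vadd ?a ?b => let e := vreify l a in let f := vreify l b in constr:(VAdd e f)
  | vopp ?a => let e := vreify l a in constr:(VOpp e)
  | vscal ?c ?a => let e := vreify l a in constr:(VScal c e)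
  | vzero => constr:(VZero)
  | ?x => let n := vindex x l in constr:(VVar n)
  end.
Ltac vec_with solver :=
  unfold dist;
  match goal with
  | |- ?s = ?t =>
      let X := type of s in
      let l1 := vcollect (@nil X) s in
      let l := vcollect l1 t in
      let e := vreify l s in
      let f := vreify l t in
      let n := eval cbn in (length l) in
      change (veval l e = veval l f);
      apply (veval_eq l n); [reflexivity|reflexivity|cbn; repeat split; solver]
  end.
Ltac vec := vec_with ltac:(ring).

(** * Norms and distances *)

Lemma vnorm_zero {X : Banach} : vnorm (vzero : X) = 0.
Proof. rewrite <- (vscal_0_l vzero), vnorm_scal, Rabs_R0. lra. Qed.

Lemma vnorm_opp {X : Banach} (x : X) : vnorm (vopp x) = vnorm x.
Proof. rewrite vopp_scal, vnorm_scal, Rabs_left by lra. lra. Qed.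

Lemma vnorm_pos {X : Banach} (x : X) : 0 <= vnorm x.
Proof.
  pose proof (vnorm_triangle _ x (vopp x)) as H.
  rewrite vadd_opp, vnorm_zero, vnorm_opp in H. lra.
Qed.

Lemma dist_pos {X : Banach} (x y : X) : 0 <= dist x y.
Proof. apply vnorm_pos. Qed.

Lemma dist_refl {X : Banach} (x : X) : dist x x = 0.
Proof. unfold dist. rewrite vadd_opp. apply vnorm_zero. Qed.

Lemma dist_sym {X : Banach} (x y : X) : dist x y = dist y x.
Proof.
  unfold dist. rewrite <- vnorm_opp. f_equal. vec.
Qed.

Lemma dist_triangle {X : Banach} (x y z : X) : dist x z <= dist x y + dist y z.
Proof.
  unfold dist.
  replace (vadd x (vopp z)) with (vadd (vadd x (vopp y)) (vadd y (vopp z))) by vec.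
  apply vnorm_triangle.
Qed.

Lemma dist_eq0 {X : Banach} (x y : X) : dist x y = 0 -> x = y.
Proof.
  intros H. apply vnorm_eq0 in H.
  apply (vadd_cancel _ _ (vopp y)). now rewrite H, vadd_opp.
Qed.

Lemma dist_0_r {X : Banach} (x : X) : dist x vzero = vnorm x.
Proof. unfold dist. f_equal. vec. Qed.

Lemma dist_0_l {X : Banach} (x : X) : dist vzero x = vnorm x.
Proof. rewrite dist_sym. apply dist_0_r. Qed.

Lemma dist_scal {X : Banach} a (x y : X) : dist (vscal a x) (vscal a y) = Rabs a * dist x y.
Proof. unfold dist. rewrite <- vnorm_scal. f_equal. vec. Qed.

Lemma dist_le_norms {X : Banach} (x y : X) : dist x y <= vnorm x + vnorm y.
Proof. unfold dist. rewrite <- (vnorm_opp y). apply vnorm_triangle. Qed.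

Lemma vnorm_le_dist {X : Banach} (x y : X) : vnorm x <= vnorm y + dist x y.
Proof.
  rewrite <- (dist_0_r x), <- (dist_0_r y), Rplus_comm. apply dist_triangle.
Qed.

Lemma vnorm_Rabs_dist {X : Banach} (x y : X) : Rabs (vnorm x - vnorm y) <= dist x y.
Proof.
  pose proof (vnorm_le_dist x y). pose proof (vnorm_le_dist y x).
  rewrite (dist_sym y x) in *. apply Rabs_le. lra.
Qed.

Lemma dist_add {X : Banach} (x y x' y' : X) :
  dist (vadd x y) (vadd x' y') <= dist x x' + dist y y'.
Proof.
  unfold dist.
  replace (vadd (vadd x y) (vopp (vadd x' y')))
    with (vadd (vadd x (vopp x')) (vadd y (vopp y'))) by vec.
  apply vnorm_triangle.
Qed.

Lemma dist_quad {X : Banach} (x y x' y' : X) :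
  Rabs (dist x y - dist x' y') <= dist x x' + dist y y'.
Proof.
  pose proof (dist_triangle x x' y) as H1. pose proof (dist_triangle x' y' y) as H2.
  pose proof (dist_triangle x' x y') as H3. pose proof (dist_triangle x y y') as H4.
  rewrite (dist_sym x' x) in H3. rewrite (dist_sym y' y) in H2.
  apply Rabs_le. lra.
Qed.

(** * Limits along an ultrafilter *)

Section Ultralimits.
Variable U : (nat -> Prop) -> Prop.
Hypothesis HU : ultrafilter U.

Lemma uf_true : U (fun _ => True).
Proof. apply HU. Qed.

Lemma uf_mono (A B : nat -> Prop) : U A -> (forall n, A n -> B n) -> U B.
Proof. apply HU. Qed.

Lemma uf_and (A B : nat -> Prop) : U A -> U B -> U (fun n => A n /\ B n).
Proof. apply HU. Qed.

Lemma uf_not (A : nat -> Prop) : ~ U A -> U (fun n => ~ A n).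
Proof. destruct HU as (_ & _ & _ & _ & H). intros HA. destruct (H A); tauto. Qed.

Lemma uf_all (A : nat -> Prop) : (forall n, A n) -> U A.
Proof. intros H. apply (uf_mono _ _ uf_true). auto. Qed.

Lemma uf_ex (A : nat -> Prop) : U A -> exists n, A n.
Proof.
  intros H. apply NNPP. intros Hn.
  destruct HU as (_ & H0 & _). apply H0.
  apply (uf_mono _ _ H). intros n An. apply Hn. now exists n.
Qed.

Lemma uf_mono2 (A B C : nat -> Prop) :
  U A -> U B -> (forall n, A n -> B n -> C n) -> U C.
Proof. intros HA HB H. apply (uf_mono _ _ (uf_and _ _ HA HB)). intros n []; auto. Qed.

Lemma uf_forall_lt (P : nat -> nat -> Prop) n :
  (forall i, (i < n)%nat -> U (P i)) -> U (fun k => forall i, (i < n)%nat -> P i k).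
Proof.
  induction n as [|n IH]; intros H.
  - apply uf_all. intros k i Hi. lia.
  - apply (uf_mono2 _ _ _ (IH (fun i Hi => H i (Nat.lt_lt_succ_r _ _ Hi)))
      (H n (Nat.lt_succ_diag_r n))).
    intros k H1 H2 i Hi. destruct (Nat.eq_dec i n) as [->|]; [auto|]. apply H1. lia.
Qed.

Lemma uf_gt : nonprincipal U -> forall k, U (fun n => (k < n)%nat).
Proof.
  intros HN k.
  apply (uf_mono (fun n => forall i, (i < S k)%nat -> n <> i)).
  - apply (uf_forall_lt (fun i n => n <> i)). intros i _. apply uf_not. apply HN.
  - intros n H. apply Nat.nle_gt. intros Hle. apply (H n); lia.
Qed.

Lemma ulim_unique a L M : ulim U a L -> ulim U a M -> L = M.
Proof.
  intros HL HM. apply NNPP. intros Hne.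
  assert (He : 0 < Rabs (L - M) / 2).
  { assert (0 < Rabs (L - M)) by (apply Rabs_pos_lt; lra). lra. }
  destruct (uf_ex _ (uf_and _ _ (HL _ He) (HM _ He))) as [n [H1 H2]].
  rewrite Rabs_minus_sym in H1.
  pose proof (Rabs_triang (L - a n) (a n - M)) as H.
  replace (L - a n + (a n - M)) with (L - M) in H by ring. lra.
Qed.

(** The limit is the supremum of the levels [r] such that [r <= a n] for [U]-almost all [n]. *)
Lemma ulim_exists a M : (forall n, Rabs (a n) <= M) -> exists L, ulim U a L.
Proof.
  intros Hb.
  destruct (completeness (fun r => U (fun n => r <= a n))) as [L [HL1 HL2]].
  - exists M. intros r Hr. destruct (uf_ex _ Hr) as [n Hn].
    pose proof (Hb n). pose proof (Rle_abs (a n)). lra.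
  - exists (- M). apply uf_all. intros n. specialize (Hb n).
    pose proof (Rle_abs (- a n)). rewrite Rabs_Ropp in *. lra.
  - exists L. intros e He.
    assert (H1 : U (fun n => L - e < a n)).
    { apply NNPP. intros Hn. apply uf_not in Hn.
      assert (L <= L - e); [|lra]. apply HL2. intros r Hr.
      destruct (uf_ex _ (uf_and _ _ Hn Hr)) as [n [H1 H2]]. lra. }
    assert (H2 : U (fun n => a n < L + e)).
    { apply NNPP. intros Hn. apply uf_not in Hn.
      assert (L + e <= L); [|lra]. apply HL1.
      apply (uf_mono _ _ Hn). intros n H. lra. }
    apply (uf_mono2 _ _ _ H1 H2). intros n H3 H4. apply Rabs_def1; lra.
Qed.

Lemma ulim_const c : ulim U (fun _ => c) c.
Proof. intros e He. apply uf_all. intros _. rewrite Rminus_diag, Rabs_R0. exact He. Qed.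

Lemma ulim_near a b L :
  (forall e, 0 < e -> U (fun n => Rabs (a n - b n) <= e)) -> ulim U a L -> ulim U b L.
Proof.
  intros Hab Ha e He.
  apply (uf_mono2 _ _ _ (Hab (e / 2) ltac:(lra)) (Ha (e / 2) ltac:(lra))).
  intros n H1 H2. rewrite Rabs_minus_sym in H1.
  pose proof (Rabs_triang (b n - a n) (a n - L)) as H.
  replace (b n - a n + (a n - L)) with (b n - L) in H by ring. lra.
Qed.

Lemma ulim_eq_on a b L : U (fun n => a n = b n) -> ulim U a L -> ulim U b L.
Proof.
  intros Hab. apply ulim_near. intros e He. apply (uf_mono _ _ Hab).
  intros n ->. rewrite Rminus_diag, Rabs_R0. lra.
Qed.

Lemma ulim_plus a b L M : ulim U a L -> ulim U b M -> ulim U (fun n => a n + b n) (L + M).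
Proof.
  intros Ha Hb e He.
  apply (uf_mono2 _ _ _ (Ha (e / 2) ltac:(lra)) (Hb (e / 2) ltac:(lra))).
  intros n H1 H2. pose proof (Rabs_triang (a n - L) (b n - M)) as H.
  replace (a n + b n - (L + M)) with (a n - L + (b n - M)) by ring. lra.
Qed.

Lemma ulim_scal c a L : ulim U a L -> ulim U (fun n => c * a n) (c * L).
Proof.
  intros Ha e He.
  assert (Hc : 0 < Rabs c + 1) by (pose proof (Rabs_pos c); lra).
  apply (uf_mono _ _ (Ha (e / (Rabs c + 1)) (Rdiv_lt_0_compat _ _ He Hc))).
  intros n H. rewrite <- Rmult_minus_distr_l, Rabs_mult.
  apply Rmult_lt_compat_r with (r := Rabs c + 1) in H; [|exact Hc].
  replace (e / (Rabs c + 1) * (Rabs c + 1)) with e in H by (field; lra).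
  pose proof (Rabs_pos (a n - L)). pose proof (Rabs_pos c). nra.
Qed.

Lemma ulim_minus a b L M : ulim U a L -> ulim U b M -> ulim U (fun n => a n - b n) (L - M).
Proof.
  intros Ha Hb. pose proof (ulim_plus _ _ _ _ Ha (ulim_scal (-1) _ _ Hb)) as H.
  replace (L + -1 * M) with (L - M) in H by ring.
  revert H. apply ulim_eq_on. apply uf_all. intros n. ring.
Qed.

Lemma ulim_le a b L M : ulim U a L -> ulim U b M -> U (fun n => a n <= b n) -> L <= M.
Proof.
  intros Ha Hb Hab. apply Rnot_lt_le. intros Hlt.
  destruct (uf_ex _ (uf_and _ _ Hab (uf_and _ _ (Ha ((L - M) / 2) ltac:(lra))
    (Hb ((L - M) / 2) ltac:(lra))))) as [n [H1 [H2 H3]]].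
  apply Rabs_def2 in H2. apply Rabs_def2 in H3. lra.
Qed.

Lemma ulim_le_const a L c : ulim U a L -> U (fun n => a n <= c) -> L <= c.
Proof. intros Ha H. exact (ulim_le _ _ _ _ Ha (ulim_const c) H). Qed.

Lemma ulim_ge_const a L c : ulim U a L -> U (fun n => c <= a n) -> c <= L.
Proof. intros Ha H. exact (ulim_le _ _ _ _ (ulim_const c) Ha H). Qed.

Lemma ulim_lt_const a L c : ulim U a L -> L < c -> U (fun n => a n < c).
Proof.
  intros Ha H. apply (uf_mono _ _ (Ha (c - L) ltac:(lra))).
  intros n Hn. apply Rabs_def2 in Hn. lra.
Qed.

Lemma ulim_gt_const a L c : ulim U a L -> c < L -> U (fun n => c < a n).
Proof.
  intros Ha H. apply (uf_mono _ _ (Ha (L - c) ltac:(lra))).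
  intros n Hn. apply Rabs_def2 in Hn. lra.
Qed.

End Ultralimits.

(* Arbitrary when the limit does not exist. *)
Definition Ulim (U : (nat -> Prop) -> Prop) (a : nat -> R) : R :=
  epsilon (inhabits 0) (ulim U a).

Lemma Ulim_spec U a M : ultrafilter U -> (forall n, Rabs (a n) <= M) -> ulim U a (Ulim U a).
Proof.
  intros HU Hb. apply (epsilon_spec (inhabits 0) (ulim U a)). exact (ulim_exists U HU a M Hb).
Qed.

(** * Ultrapowers *)

Lemma half_pow_small (e : R) : 0 < e -> exists p, forall q, (p <= q)%nat -> (1 / 2) ^ q < e.
Proof.
  intros He. destruct (pow_lt_1_zero (1 / 2) ltac:(rewrite Rabs_right; lra) e He) as [p Hp].
  exists p. intros q Hq. specialize (Hp q Hq).
  pose proof (Rle_abs ((1 / 2) ^ q)). lra.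
Qed.

Lemma half_pow_pos p : 0 < (1 / 2) ^ p.
Proof. apply pow_lt. lra. Qed.

Lemma dist_geometric {Y : Banach} (w : nat -> Y) :
  (forall p, dist (w (S p)) (w p) <= (1 / 2) ^ p) ->
  forall p q, (p <= q)%nat -> dist (w q) (w p) <= 2 * (1 / 2) ^ p - 2 * (1 / 2) ^ q.
Proof.
  intros Hw p q Hq. induction Hq as [|q Hq IH].
  - rewrite dist_refl. lra.
  - pose proof (dist_triangle (w (S q)) (w q) (w p)). specialize (Hw q). simpl. lra.
Qed.

Lemma geometric_limit {Y : Banach} (w : nat -> Y) :
  (forall p, dist (w (S p)) (w p) <= (1 / 2) ^ p) ->
  exists l, forall p, dist (w p) l <= 2 * (1 / 2) ^ p.
Proof.
  intros Hw. pose proof (dist_geometric w Hw) as Hd.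
  destruct (vcomplete _ w) as [l Hl].
  - intros e He. destruct (half_pow_small (e / 4) ltac:(lra)) as [N HN].
    exists N. intros m n Hm Hn.
    change (dist (w m) (w n) < e).
    pose proof (dist_triangle (w m) (w N) (w n)). rewrite (dist_sym (w N)) in H.
    pose proof (Hd N m Hm). pose proof (Hd N n Hn).
    pose proof (half_pow_pos m). pose proof (half_pow_pos n).
    specialize (HN N (Nat.le_refl _)). lra.
  - exists l. intros p. apply Rnot_lt_le. intros Hlt.
    destruct (Hl (dist (w p) l - 2 * (1 / 2) ^ p) ltac:(lra)) as [N HN].
    specialize (HN (max N p) (Nat.le_max_l _ _)).
    change (dist (w (max N p)) l < dist (w p) l - 2 * (1 / 2) ^ p) in HN.
    pose proof (Hd p (max N p) (Nat.le_max_r _ _)).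
    pose proof (dist_triangle (w p) (w (max N p)) l).
    rewrite (dist_sym (w p) (w (max N p))) in H0.
    pose proof (half_pow_pos (max N p)). lra.
Qed.

Section Ultrapower.
Variable Y : Banach.
Variable U : (nat -> Prop) -> Prop.
Hypothesis HU : ultrafilter U.

Definition ueqv (a b : nat -> Y) : Prop :=
  forall e, 0 < e -> U (fun k => dist (a k) (b k) < e).

Lemma ueqv_ext a b : (forall k, a k = b k) -> ueqv a b.
Proof. intros H e He. apply (uf_all U HU). intros k. now rewrite H, dist_refl. Qed.

Lemma ueqv_refl a : ueqv a a.
Proof. now apply ueqv_ext. Qed.

Lemma ueqv_sym a b : ueqv a b -> ueqv b a.
Proof. intros H e He. apply (uf_mono U HU _ _ (H e He)). intros k. now rewrite dist_sym. Qed.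

Lemma ueqv_trans b a c : ueqv a b -> ueqv b c -> ueqv a c.
Proof.
  intros H1 H2 e He.
  apply (uf_mono2 U HU _ _ _ (H1 (e / 2) ltac:(lra)) (H2 (e / 2) ltac:(lra))).
  intros k. pose proof (dist_triangle (a k) (b k) (c k)). lra.
Qed.

Lemma ueqv_add a b c d : ueqv a c -> ueqv b d ->
  ueqv (fun k => vadd (a k) (b k)) (fun k => vadd (c k) (d k)).
Proof.
  intros H1 H2 e He.
  apply (uf_mono2 U HU _ _ _ (H1 (e / 2) ltac:(lra)) (H2 (e / 2) ltac:(lra))).
  intros k. pose proof (dist_add (a k) (b k) (c k) (d k)). lra.
Qed.

Lemma ueqv_scal r a c : ueqv a c -> ueqv (fun k => vscal r (a k)) (fun k => vscal r (c k)).
Proof.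
  intros H e He. assert (Hr : 0 < Rabs r + 1) by (pose proof (Rabs_pos r); lra).
  apply (uf_mono U HU _ _ (H _ (Rdiv_lt_0_compat _ _ He Hr))). intros k Hk.
  rewrite dist_scal. apply Rmult_lt_compat_r with (r := Rabs r + 1) in Hk; [|exact Hr].
  replace (e / (Rabs r + 1) * (Rabs r + 1)) with e in Hk by (field; lra).
  pose proof (dist_pos (a k) (c k)). pose proof (Rabs_pos r). nra.
Qed.

(* Vectors of the ultrapower are canonical representatives of the classes of bounded
   sequences, so that Leibniz equality is equality of classes. *)
Definition urep (a : nat -> Y) : nat -> Y :=
  epsilon (inhabits (fun _ => vzero)) (fun b => bounded_seq b /\ ueqv a b).

Lemma urep_spec a : bounded_seq a -> bounded_seq (urep a) /\ ueqv a (urep a).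
Proof.
  intros Ha.
  apply (epsilon_spec (inhabits (fun _ => vzero)) (fun b => bounded_seq b /\ ueqv a b)).
  exists a. split; [exact Ha|apply ueqv_refl].
Qed.

Lemma urep_eq a b : ueqv a b -> urep a = urep b.
Proof.
  intros H. unfold urep. f_equal. apply functional_extensionality. intros c.
  apply propositional_extensionality.
  split; intros [H1 H2]; (split; [exact H1|]).
  - exact (ueqv_trans _ _ _ (ueqv_sym _ _ H) H2).
  - exact (ueqv_trans _ _ _ H H2).
Qed.

Definition uvec : Type := {a : nat -> Y | bounded_seq a /\ urep a = a}.

Definition ucoord (x : uvec) : nat -> Y := proj1_sig x.

Lemma ucoord_bounded x : bounded_seq (ucoord x).
Proof. exact (proj1 (proj2_sig x)). Qed.

Definition uclass (a : nat -> Y) (Ha : bounded_seq a) : uvec :=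
  exist _ (urep a) (conj (proj1 (urep_spec a Ha))
    (eq_sym (urep_eq _ _ (proj2 (urep_spec a Ha))))).

Lemma ucoord_class a Ha : ueqv (ucoord (uclass a Ha)) a.
Proof. apply ueqv_sym. exact (proj2 (urep_spec a Ha)). Qed.

Lemma uvec_eq x y : ueqv (ucoord x) (ucoord y) -> x = y.
Proof.
  destruct x as [a [Ha Ra]], y as [b [Hb Rb]]. unfold ucoord; simpl. intros H.
  apply subset_eq_compat. rewrite <- Ra, <- Rb. now apply urep_eq.
Qed.

Lemma bounded_add (a b : nat -> Y) :
  bounded_seq a -> bounded_seq b -> bounded_seq (fun k => vadd (a k) (b k)).
Proof.
  intros [M HM] [N HN]. exists (M + N). intros k.
  pose proof (vnorm_triangle _ (a k) (b k)). specialize (HM k). specialize (HN k). lra.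
Qed.

Lemma bounded_scal r (a : nat -> Y) : bounded_seq a -> bounded_seq (fun k => vscal r (a k)).
Proof.
  intros [M HM]. exists (Rabs r * M). intros k. rewrite vnorm_scal.
  apply Rmult_le_compat_l; [apply Rabs_pos|apply HM].
Qed.

Lemma bounded_opp (a : nat -> Y) : bounded_seq a -> bounded_seq (fun k => vopp (a k)).
Proof. intros [M HM]. exists M. intros k. rewrite vnorm_opp. apply HM. Qed.

Lemma bounded_zero : bounded_seq (fun _ => vzero : Y).
Proof. exists 0. intros _. rewrite vnorm_zero. lra. Qed.

Definition uzero : uvec := uclass _ bounded_zero.
Definition uadd (x y : uvec) : uvec :=
  uclass _ (bounded_add _ _ (ucoord_bounded x) (ucoord_bounded y)).
Definition uopp (x : uvec) : uvec := uclass _ (bounded_opp _ (ucoord_bounded x)).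
Definition uscal r (x : uvec) : uvec := uclass _ (bounded_scal r _ (ucoord_bounded x)).
Definition unorm (x : uvec) : R := Ulim U (fun k => vnorm (ucoord x k)).

Lemma ucoord_add x y :
  ueqv (ucoord (uadd x y)) (fun k => vadd (ucoord x k) (ucoord y k)).
Proof. apply ucoord_class. Qed.
Lemma ucoord_opp x : ueqv (ucoord (uopp x)) (fun k => vopp (ucoord x k)).
Proof. apply ucoord_class. Qed.
Lemma ucoord_scal r x : ueqv (ucoord (uscal r x)) (fun k => vscal r (ucoord x k)).
Proof. apply ucoord_class. Qed.
Lemma ucoord_zero : ueqv (ucoord uzero) (fun _ => vzero).
Proof. apply ucoord_class. Qed.

Lemma unorm_spec x a : ueqv (ucoord x) a -> ulim U (fun k => vnorm (a k)) (unorm x).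
Proof.
  intros H. destruct (ucoord_bounded x) as [M HM].
  apply (ulim_near U HU (fun k => vnorm (ucoord x k))).
  - intros e He. apply (uf_mono U HU _ _ (H e He)). intros k Hk.
    pose proof (vnorm_Rabs_dist (ucoord x k) (a k)). lra.
  - apply (Ulim_spec U _ M HU). intros k. rewrite Rabs_right; [apply HM|].
    apply Rle_ge, vnorm_pos.
Qed.

Lemma udist_spec x y :
  ulim U (fun k => dist (ucoord x k) (ucoord y k)) (unorm (uadd x (uopp y))).
Proof.
  apply (unorm_spec (uadd x (uopp y)) (fun k => vadd (ucoord x k) (vopp (ucoord y k)))).
  apply (ueqv_trans _ _ _ (ucoord_add _ _)).
  apply ueqv_add; [apply ueqv_refl|apply ucoord_opp].
Qed.

Ltac uext := apply ueqv_ext; intros k; vec.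

Lemma uadd_assoc x y z : uadd x (uadd y z) = uadd (uadd x y) z.
Proof.
  apply uvec_eq.
  apply (ueqv_trans (fun k => vadd (ucoord x k) (vadd (ucoord y k) (ucoord z k)))).
  - apply (ueqv_trans _ _ _ (ucoord_add _ _)), ueqv_add; [apply ueqv_refl|apply ucoord_add].
  - apply ueqv_sym. apply (ueqv_trans _ _ _ (ucoord_add _ _)).
    apply (ueqv_trans _ _ _ (ueqv_add _ _ _ _ (ucoord_add _ _) (ueqv_refl _))). uext.
Qed.

Lemma uadd_comm x y : uadd x y = uadd y x.
Proof.
  apply uvec_eq. apply (ueqv_trans _ _ _ (ucoord_add _ _)).
  apply ueqv_sym, (ueqv_trans _ _ _ (ucoord_add _ _)). uext.
Qed.

Lemma uadd_0 x : uadd x uzero = x.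
Proof.
  apply uvec_eq. apply (ueqv_trans _ _ _ (ucoord_add _ _)).
  apply (ueqv_trans _ _ _ (ueqv_add _ _ _ _ (ueqv_refl _) ucoord_zero)). uext.
Qed.

Lemma uadd_opp x : uadd x (uopp x) = uzero.
Proof.
  apply uvec_eq. apply (ueqv_trans _ _ _ (ucoord_add _ _)).
  apply (ueqv_trans _ _ _ (ueqv_add _ _ _ _ (ueqv_refl _) (ucoord_opp _))).
  apply ueqv_sym, (ueqv_trans _ _ _ ucoord_zero). uext.
Qed.

Lemma uscal_1 x : uscal 1 x = x.
Proof. apply uvec_eq, (ueqv_trans _ _ _ (ucoord_scal _ _)). uext. Qed.

Lemma uscal_assoc a b x : uscal a (uscal b x) = uscal (a * b) x.
Proof.
  apply uvec_eq, (ueqv_trans _ _ _ (ucoord_scal _ _)).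
  apply (ueqv_trans _ _ _ (ueqv_scal _ _ _ (ucoord_scal _ _))).
  apply ueqv_sym, (ueqv_trans _ _ _ (ucoord_scal _ _)). uext.
Qed.

Lemma uscal_distr_v a x y : uscal a (uadd x y) = uadd (uscal a x) (uscal a y).
Proof.
  apply uvec_eq, (ueqv_trans _ _ _ (ucoord_scal _ _)).
  apply (ueqv_trans _ _ _ (ueqv_scal _ _ _ (ucoord_add _ _))).
  apply ueqv_sym, (ueqv_trans _ _ _ (ucoord_add _ _)).
  apply (ueqv_trans _ _ _ (ueqv_add _ _ _ _ (ucoord_scal _ _) (ucoord_scal _ _))). uext.
Qed.

Lemma uscal_distr_s a b x : uscal (a + b) x = uadd (uscal a x) (uscal b x).
Proof.
  apply uvec_eq, (ueqv_trans _ _ _ (ucoord_scal _ _)).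
  apply ueqv_sym, (ueqv_trans _ _ _ (ucoord_add _ _)).
  apply (ueqv_trans _ _ _ (ueqv_add _ _ _ _ (ucoord_scal _ _) (ucoord_scal _ _))). uext.
Qed.

Lemma unorm_eq0 x : unorm x = 0 -> x = uzero.
Proof.
  intros H. pose proof (unorm_spec x _ (ueqv_refl _)) as Hx. rewrite H in Hx.
  apply uvec_eq. apply (ueqv_trans (fun _ => vzero)); [|apply ueqv_sym, ucoord_zero].
  intros e He. apply (uf_mono U HU _ _ (Hx e He)). intros k Hk. rewrite dist_0_r.
  rewrite Rminus_0_r in Hk. pose proof (Rle_abs (vnorm (ucoord x k))). lra.
Qed.

Lemma unorm_scal a x : unorm (uscal a x) = Rabs a * unorm x.
Proof.
  apply (ulim_unique U HU (fun k => vnorm (vscal a (ucoord x k)))).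
  - apply unorm_spec, ucoord_scal.
  - apply (ulim_eq_on U HU (fun k => Rabs a * vnorm (ucoord x k))).
    + apply (uf_all U HU). intros k. symmetry. apply vnorm_scal.
    + apply ulim_scal; [exact HU|]. apply unorm_spec, ueqv_refl.
Qed.

Lemma unorm_triangle x y : unorm (uadd x y) <= unorm x + unorm y.
Proof.
  apply (ulim_le U HU (fun k => vnorm (vadd (ucoord x k) (ucoord y k)))
    (fun k => vnorm (ucoord x k) + vnorm (ucoord y k))).
  - apply unorm_spec, ucoord_add.
  - apply ulim_plus; [exact HU| |]; apply unorm_spec, ueqv_refl.
  - apply (uf_all U HU). intros k. apply vnorm_triangle.
Qed.

(* A fast Cauchy sequence [b] of classes is replaced by representatives [w] whose steps
   are small at every index, so that they converge pointwise in [Y]. *)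
Lemma ufast_limit (b : nat -> uvec) :
  (forall p, unorm (uadd (b (S p)) (uopp (b p))) < (1 / 2) ^ p) ->
  exists l, forall p, unorm (uadd (b p) (uopp l)) <= 2 * (1 / 2) ^ p.
Proof.
  intros Hb.
  (* Where the step from [b p] to [b (S p)] is too long, [w] stands still. For each [p] this happens
     on a null set of indices only, so [w p] still represents [b p]. *)
  pose (step := fun p k => if Rlt_dec (dist (ucoord (b (S p)) k) (ucoord (b p) k)) ((1 / 2) ^ p)
    then vadd (ucoord (b (S p)) k) (vopp (ucoord (b p) k)) else vzero).
  pose (w := fix w p k := match p with
    | O => ucoord (b O) k
    | S q => vadd (w q k) (step q k) end).
  assert (Hw : forall p k, dist (w (S p) k) (w p k) <= (1 / 2) ^ p).
  { intros p k. simpl.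
    replace (dist (vadd (w p k) (step p k)) (w p k)) with (vnorm (step p k))
      by (unfold dist; f_equal; vec).
    unfold step. destruct (Rlt_dec _ _) as [H|H]; [unfold dist in H; lra|].
    rewrite vnorm_zero. pose proof (half_pow_pos p). lra. }
  assert (Hwb : forall p, U (fun k => w p k = ucoord (b p) k)).
  { induction p as [|p IH]; [now apply (uf_all U HU)|].
    apply (uf_mono2 U HU _ _ _ IH (ulim_lt_const U HU _ _ _ (udist_spec _ _) (Hb p))).
    intros k H1 H2. simpl. rewrite H1. unfold step.
    destruct (Rlt_dec _ _) as [_|H]; [vec|contradiction]. }
  destruct (choice (fun k l => forall p, dist (w p k) l <= 2 * (1 / 2) ^ p)) as [l Hl].
  { intros k. apply (geometric_limit (fun p => w p k)). intros p. apply Hw. }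
  assert (Bl : bounded_seq l).
  { destruct (ucoord_bounded (b O)) as [M HM]. exists (M + 2). intros k.
    specialize (Hl k O). specialize (HM k). simpl in Hl.
    pose proof (vnorm_le_dist (l k) (ucoord (b O) k)). rewrite dist_sym in H. lra. }
  exists (uclass l Bl). intros p.
  apply (ulim_le_const U HU (fun k => dist (ucoord (b p) k) (l k))).
  - apply (ulim_near U HU (fun k => dist (ucoord (b p) k) (ucoord (uclass l Bl) k)));
      [|apply udist_spec].
    intros e He. apply (uf_mono U HU _ _ (ucoord_class l Bl e He)). intros k Hk.
    eapply Rle_trans; [apply dist_quad|]. rewrite dist_refl. lra.
  - apply (uf_mono U HU _ _ (Hwb p)). intros k <-. apply Hl.
Qed.

Lemma ucomplete (u : nat -> uvec) :
  (forall eps, 0 < eps -> exists N, forall m n, (N <= m)%nat -> (N <= n)%nat ->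
      unorm (uadd (u m) (uopp (u n))) < eps) ->
  exists l, forall eps, 0 < eps -> exists N, forall n, (N <= n)%nat ->
      unorm (uadd (u n) (uopp l)) < eps.
Proof.
  intros Hu.
  destruct (choice (fun p N => forall m n, (N <= m)%nat -> (N <= n)%nat ->
      unorm (uadd (u m) (uopp (u n))) < (1 / 2) ^ p)) as [N HN].
  { intros p. apply Hu, half_pow_pos. }
  pose (phi := fix phi p := match p with O => N O | S q => max (N (S q)) (phi q) end).
  assert (Hphi : forall p, (N p <= phi p)%nat) by (destruct p; simpl; lia).
  destruct (ufast_limit (fun p => u (phi p))) as [l Hl].
  { intros p. apply HN; [|apply Hphi]. pose proof (Hphi p). simpl. lia. }
  exists l. intros e He. destruct (half_pow_small (e / 4) ltac:(lra)) as [p Hp].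
  specialize (Hp p (Nat.le_refl _)). exists (phi p). intros n Hn.
  pose proof (unorm_triangle (uadd (u n) (uopp (u (phi p)))) (uadd (u (phi p)) (uopp l))) as Ht.
  replace (uadd (uadd (u n) (uopp (u (phi p)))) (uadd (u (phi p)) (uopp l)))
    with (uadd (u n) (uopp l)) in Ht.
  - pose proof (Hl p). pose proof (HN p n (phi p)). pose proof (Hphi p).
    specialize (H0 ltac:(lia) H1). pose proof (half_pow_pos p). lra.
  - rewrite <- uadd_assoc. f_equal. rewrite uadd_assoc.
    now rewrite (uadd_comm (uopp _)), uadd_opp, uadd_comm, uadd_0.
Qed.

Definition ultrapower : Banach := {|
  vec := uvec; vzero := uzero; vadd := uadd; vopp := uopp; vscal := uscal; vnorm := unorm;
  vadd_assoc := uadd_assoc; vadd_comm := uadd_comm; vadd_0 := uadd_0; vadd_opp := uadd_opp;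
  vscal_1 := uscal_1; vscal_assoc := uscal_assoc; vscal_distr_v := uscal_distr_v;
  vscal_distr_s := uscal_distr_s; vnorm_eq0 := unorm_eq0; vnorm_scal := unorm_scal;
  vnorm_triangle := unorm_triangle; vcomplete := ucomplete |}.

Lemma ultrapower_dist (a b : nat -> Y) (Ha : bounded_seq a) (Hb : bounded_seq b) :
  ulim U (fun k => dist (a k) (b k)) (@dist ultrapower (uclass a Ha) (uclass b Hb)).
Proof.
  apply (ulim_near U HU (fun k => dist (ucoord (uclass a Ha) k) (ucoord (uclass b Hb) k)));
    [|apply udist_spec].
  intros e He.
  apply (uf_mono2 U HU _ _ _ (ucoord_class a Ha (e / 2) ltac:(lra))
    (ucoord_class b Hb (e / 2) ltac:(lra))).
  intros k H1 H2. eapply Rle_trans; [apply dist_quad|]. lra.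
Qed.

End Ultrapower.

(** * Finite representability of an ultrapower in its base space *)

Lemma vnorm_lincomb_le {X : Banach} (b : nat -> R) (w : nat -> X) m :
  vnorm (lincomb b w m) <= rsum (fun j => Rabs (b j) * vnorm (w j)) m.
Proof.
  induction m as [|m IH]; simpl; [rewrite vnorm_zero; lra|].
  pose proof (vnorm_triangle _ (lincomb b w m) (vscal (b m) (w m))) as H.
  rewrite vnorm_scal in H. lra.
Qed.

Lemma lincomb_minus {X : Banach} (a b : nat -> R) (w : nat -> X) m :
  lincomb (fun j => a j - b j) w m = vadd (lincomb a w m) (vopp (lincomb b w m)).
Proof.
  rewrite vopp_scal, <- lincomb_scal, <- lincomb_add.
  apply lincomb_ext; intros; [ring|reflexivity].
Qed.

Lemma lincomb_subst {X : Banach} (a : nat -> R) (c : nat -> nat -> R) (w : nat -> X) m n :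
  lincomb a (fun i => lincomb (c i) w m) n
  = lincomb (fun j => rsum (fun i => a i * c i j) n) w m.
Proof.
  induction n as [|n IH]; simpl; [symmetry; apply lincomb_zero|].
  rewrite IH, <- lincomb_scal, <- lincomb_add. reflexivity.
Qed.

(** Compactness of the coefficients: the lower estimate with [kappa] keeps those of the approximants
    bounded, and their limits along [U] represent [z]. *)
Lemma span_closed {X : Banach} U (HU : ultrafilter U) (HN : nonprincipal U)
    (w : nat -> X) m kappa (z : X) : 0 < kappa ->
  (forall b, kappa * rsum (fun j => Rabs (b j)) m <= vnorm (lincomb b w m)) ->
  (forall e, 0 < e -> exists b, dist z (lincomb b w m) < e) ->
  exists b, z = lincomb b w m.
Proof.
  intros Hk Hw Hz.
  destruct (choice (fun p b => dist z (lincomb b w m) < (1 / 2) ^ p)) as [b Hb].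
  { intros p. apply Hz, half_pow_pos. }
  set (M := (vnorm z + 1) / kappa).
  assert (HM : forall j p, (j < m)%nat -> Rabs (b p j) <= M).
  { intros j p Hj. apply (Rmult_le_reg_l kappa); [exact Hk|].
    unfold M. replace (kappa * ((vnorm z + 1) / kappa)) with (vnorm z + 1) by (field; lra).
    apply (Rle_trans _ (kappa * rsum (fun j => Rabs (b p j)) m)).
    - apply Rmult_le_compat_l; [lra|].
      apply (rsum_term (fun j => Rabs (b p j))); [intros; apply Rabs_pos|exact Hj].
    - eapply Rle_trans; [apply Hw|]. specialize (Hb p).
      pose proof (vnorm_le_dist (lincomb (b p) w m) z) as H. rewrite dist_sym in H.
      assert ((1 / 2) ^ p <= 1) by (rewrite <- (pow1 p) at 2; apply pow_incr; lra). lra. }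
  set (l := fun j => Ulim U (fun p => b p j)). exists l.
  apply dist_eq0, Rle_antisym; [|apply dist_pos].
  apply Rnot_lt_le. intros Hlt. set (e := dist z (lincomb l w m)) in *.
  set (A := rsum (fun j => vnorm (w j)) m).
  assert (HA : 0 <= A) by (apply rsum_pos; intros; apply vnorm_pos).
  set (h := e / 2 / (A + 1)).
  assert (Hh : 0 < h) by (apply Rdiv_lt_0_compat; lra).
  destruct (half_pow_small (e / 2) ltac:(lra)) as [q Hq].
  destruct (uf_ex U HU _ (uf_and U HU _ _ (uf_gt U HU HN q)
    (uf_forall_lt U HU (fun j p => Rabs (b p j - l j) < h) m ltac:(
      intros j Hj; apply (Ulim_spec U _ M HU (fun p => HM j p Hj) h Hh))))) as [p [Hp1 Hp2]].
  specialize (Hq p ltac:(lia)). specialize (Hb p).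
  pose proof (dist_triangle z (lincomb (b p) w m) (lincomb l w m)) as Ht.
  assert (H : dist (lincomb (b p) w m) (lincomb l w m) <= h * A).
  { unfold dist. rewrite <- lincomb_minus. eapply Rle_trans; [apply vnorm_lincomb_le|].
    unfold A. rewrite <- rsum_scal. apply rsum_le. intros j Hj.
    apply Rmult_le_compat_r; [apply vnorm_pos|]. left. auto. }
  assert (h * A <= e / 2).
  { replace (e / 2) with (h * (A + 1)) by (unfold h; field; lra). nra. }
  fold e in Ht. lra.
Qed.

(** Norms at an index of the ultrapower are controlled up to an additive error on bounded
    coefficients. The lower estimate by the l1-norm of the coefficients makes this error relative,
    but it requires independent vectors, while [fin_rep] allows arbitrary ones. By [span_closed], a
    new vector either lies in the span or has positive distance from it. *)
Lemma span_basis {X : Banach} U (HU : ultrafilter U) (HN : nonprincipal U) (z : nat -> X) n :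
  exists m (w : nat -> X) (c : nat -> nat -> R) kappa, 0 < kappa /\
    (forall i, (i < n)%nat -> z i = lincomb (c i) w m) /\
    (forall b, kappa * rsum (fun j => Rabs (b j)) m <= vnorm (lincomb b w m)).
Proof.
  induction n as [|n (m & w & c & kappa & Hk & Hc & Hw)].
  - exists O, z, (fun _ _ => 0), 1. repeat split; [lra|intros; lia|].
    intros b. simpl. rewrite vnorm_zero. lra.
  - destruct (excluded_middle_informative (exists b, z n = lincomb b w m)) as [[b Hb]|Hno].
    + exists m, w, (fun i => if Nat.eqb i n then b else c i), kappa.
      repeat split; [exact Hk| |exact Hw].
      intros i Hi. destruct (Nat.eqb_spec i n) as [->|]; [exact Hb|]. apply Hc. lia.
    + assert (Hd : exists d, 0 < d /\ forall b, d <= dist (z n) (lincomb b w m)).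
      { apply NNPP. intros Hd. apply Hno. apply (span_closed U HU HN _ _ kappa); auto.
        intros e He. apply NNPP. intros Hb. apply Hd. exists e. split; [exact He|].
        intros b. apply Rnot_lt_le. intros H. apply Hb. now exists b. }
      destruct Hd as (d & Hd & Hdb).
      set (A := vnorm (z n)). assert (HA : 0 <= A) by apply vnorm_pos.
      set (w' := fun j => if Nat.eqb j m then z n else w j).
      assert (Ew : forall b, lincomb b w' m = lincomb b w m).
      { intros b. apply lincomb_ext; [reflexivity|]. intros i Hi. unfold w'.
        destruct (Nat.eqb_spec i m); [lia|reflexivity]. }
      assert (Em : w' m = z n) by (unfold w'; now rewrite Nat.eqb_refl).
      exists (S m), w', (fun i => if Nat.eqb i n
        then (fun j => if Nat.eqb j m then 1 else 0)
        else (fun j => if Nat.eqb j m then 0 else c i j)), (kappa * d / (kappa + A + d)).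
      repeat split.
      * apply Rdiv_lt_0_compat; nra.
      * intros i Hi. destruct (Nat.eqb_spec i n) as [->|Hne].
        -- rewrite (lincomb_single w' m (S m)) by lia. now rewrite Em.
        -- simpl. rewrite Nat.eqb_refl, Ew, vscal_0_l, vadd_0, Hc by lia.
           apply lincomb_ext; [|reflexivity]. intros j Hj.
           destruct (Nat.eqb_spec j m); [lia|reflexivity].
      * intros b. simpl. rewrite Ew, Em.
        set (N := vnorm _). set (s := rsum _ _). set (t := b m).
        assert (H1 : Rabs t * d <= N).
        { destruct (Req_dec t 0) as [H0|H0].
          - rewrite H0, Rabs_R0, Rmult_0_l. apply vnorm_pos.
          - specialize (Hdb (fun j => - / t * b j)).
            rewrite lincomb_scal in Hdb.
            replace N with (Rabs t * dist (z n) (vscal (- / t) (lincomb b w m))).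
            + apply Rmult_le_compat_l; [apply Rabs_pos|exact Hdb].
            + unfold dist. rewrite <- vnorm_scal. unfold N. f_equal.
              fold t. vec_with ltac:(field; exact H0). }
        assert (H2 : kappa * s <= N + Rabs t * A).
        { eapply Rle_trans; [apply Hw|]. unfold N, A, t. rewrite <- vnorm_scal.
          rewrite <- (vnorm_opp (vscal (b m) (z n))).
          eapply Rle_trans; [|apply vnorm_triangle]. right. f_equal. vec. }
        (* The new constant arises from adding [d] times [H2] to [kappa] times [H1], with [H1]
           applied once more to the term [Rabs t * A]. *)
        assert (H3 : kappa * d * (s + Rabs t) <= N * (kappa + A + d)).
        { assert (d * (kappa * s) <= d * (N + Rabs t * A)) by (apply Rmult_le_compat_l; lra).
          assert (A * (Rabs t * d) <= A * N) by (apply Rmult_le_compat_l; lra).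
          assert (kappa * (Rabs t * d) <= kappa * N) by (apply Rmult_le_compat_l; lra).
          lra. }
        apply (Rmult_le_reg_r (kappa + A + d)); [lra|].
        replace (kappa * d / (kappa + A + d) * (s + Rabs t) * (kappa + A + d))
          with (kappa * d * (s + Rabs t)) by (field; lra). exact H3.
Qed.

Lemma grid_point (h : R) : 0 < h -> forall K t, -1 <= t <= -1 + INR K * h ->
  exists i, (i < S K)%nat /\ Rabs (t - (-1 + INR i * h)) <= h.
Proof.
  intros Hh. induction K as [|K IH]; intros t Ht.
  - exists O. simpl in *. split; [lia|]. apply Rabs_le. lra.
  - destruct (Rle_dec t (-1 + INR K * h)) as [H|H].
    + destruct (IH t ltac:(lra)) as [i [H1 H2]]. exists i. split; [lia|exact H2].
    + exists (S K). split; [lia|]. rewrite S_INR in *. apply Rabs_le. lra.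
Qed.

(** For a single [b] this is the definition of the norm. Uniformity over the cube needs finitely
    many conditions, so the coefficients are discretised one at a time; [v] and [s] are general in
    order to absorb the term already rounded. *)
Lemma ultrapower_norm_uniform (Y : Banach) U (HU : ultrafilter U)
    (w : nat -> ultrapower Y U HU) m : forall (v : ultrapower Y U HU) s e, 0 < e ->
  ueqv Y U (ucoord Y U v) s ->
  U (fun k => forall b, (forall j, (j < m)%nat -> Rabs (b j) <= 1) ->
    Rabs (vnorm (vadd (s k) (lincomb b (fun j => ucoord Y U (w j) k) m))
          - vnorm (vadd v (lincomb b w m))) <= e).
Proof.
  induction m as [|m IH]; intros v s e He Hs.
  - apply (uf_mono U HU _ _ (unorm_spec Y U HU v s Hs e He)).
    intros k Hk b _. rewrite vadd_0. cbn [lincomb]. rewrite vadd_0.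
    left. exact Hk.
  - destruct (ucoord_bounded Y U (w m)) as [B HB].
    assert (HB0 : 0 <= B).
    { specialize (HB O). pose proof (vnorm_pos (ucoord Y U (w m) O)). lra. }
    assert (HwB : vnorm (w m) <= B).
    { apply (ulim_le_const U HU (fun k => vnorm (ucoord Y U (w m) k))).
      - apply (unorm_spec Y U HU). now apply ueqv_refl.
      - now apply (uf_all U HU). }
    (* Rounding the last coefficient to mesh [h] costs at most [e / 4] in each of the two norms; the
       induction hypothesis at the grid points uses the other [e / 2]. *)
    set (h := e / 4 / (B + 1)).
    assert (Hh : 0 < h) by (apply Rdiv_lt_0_compat; lra).
    assert (HhB : h * B <= e / 4).
    { replace (e / 4) with (h * (B + 1)) by (unfold h; field; lra). nra. }
    destruct (INR_unbounded (2 / h)) as [K HK].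
    assert (HKh : 2 <= INR K * h).
    { left. apply (Rmult_lt_reg_r (/ h)); [now apply Rinv_0_lt_compat|].
      replace (INR K * h * / h) with (INR K) by (field; lra). exact HK. }
    assert (Hgrid := uf_forall_lt U HU (fun i k =>
      forall b, (forall j, (j < m)%nat -> Rabs (b j) <= 1) ->
      Rabs (vnorm (vadd (vadd (s k) (vscal (-1 + INR i * h) (ucoord Y U (w m) k)))
                (lincomb b (fun j => ucoord Y U (w j) k) m))
          - vnorm (vadd (vadd v (vscal (-1 + INR i * h) (w m))) (lincomb b w m))) <= e / 2)
      (S K)).
    refine (uf_mono U HU _ _ (Hgrid _) _).
    + intros i _. apply IH; [lra|].
      apply (ueqv_trans Y U HU _ _ _ (ucoord_add Y U HU v (uscal Y U HU (-1 + INR i * h) (w m)))).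
      apply (ueqv_add Y U HU); [exact Hs|apply ucoord_scal].
    + intros k Hk b Hb. cbn [lincomb].
      pose proof (Hb m (Nat.lt_succ_diag_r m)) as Hbm.
      destruct (grid_point h Hh K (b m)) as [i [Hi Hti]].
      { destruct (Rabs_le_inv _ _ Hbm). lra. }
      specialize (Hk i Hi b (fun j Hj => Hb j (Nat.lt_lt_succ_r _ _ Hj))).
      set (t := -1 + INR i * h) in *.
      assert (D : forall (X : Banach) (p l q : X), vnorm q <= B ->
        Rabs (vnorm (vadd p (vadd l (vscal (b m) q))) - vnorm (vadd (vadd p (vscal t q)) l))
          <= e / 4).
      { intros X p l q Hq. eapply Rle_trans; [apply vnorm_Rabs_dist|].
        replace (dist _ _) with (vnorm (vscal (b m - t) q)) by (unfold dist; f_equal; vec).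
        rewrite vnorm_scal. pose proof (vnorm_pos q). pose proof (Rabs_pos (b m - t)). nra. }
      pose proof (D _ (s k) (lincomb b (fun j => ucoord Y U (w j) k) m) _ (HB k)) as D1.
      pose proof (D _ v (lincomb b w m) (w m) HwB) as D2.
      apply Rabs_le_inv in Hk. apply Rabs_le_inv in D1. apply Rabs_le_inv in D2.
      apply Rabs_le. lra.
Qed.

(** All vectors are replaced by their coordinates at one index [k], chosen for error [e * kappa] on
    the unit cube of coefficients. By homogeneity the error is [e * kappa * s] in general, and
    [span_basis] bounds [kappa * s] by the norm. *)
Lemma ultrapower_fin_rep (Y : Banach) U (HU : ultrafilter U) :
  nonprincipal U -> fin_rep (ultrapower Y U HU) Y.
Proof.
  intros HN n z e He.
  destruct (span_basis U HU HN z n) as (m & w & c & kappa & Hk & Hc & Hw).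
  destruct (uf_ex U HU _ (ultrapower_norm_uniform Y U HU w m vzero (fun _ => vzero)
    (e * kappa) ltac:(nra) (ucoord_zero Y U HU))) as [k Hu].
  set (wk := fun j => ucoord Y U (w j) k) in *.
  exists (fun i => lincomb (c i) wk m). intros a.
  rewrite lincomb_subst.
  rewrite (lincomb_ext a a z (fun i => lincomb (c i) w m) n (fun _ _ => eq_refl) Hc).
  rewrite lincomb_subst.
  set (b := fun j => rsum (fun i => a i * c i j) n). specialize (Hw b).
  set (s := rsum (fun j => Rabs (b j)) m) in *.
  assert (Hs : 0 <= s) by (apply rsum_pos; intros; apply Rabs_pos).
  assert (Hbs : forall j, (j < m)%nat -> Rabs (b j) <= s).
  { intros j Hj. apply (rsum_term (fun j => Rabs (b j))); [intros; apply Rabs_pos|exact Hj]. }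
  assert (H : Rabs (vnorm (lincomb b wk m) - vnorm (lincomb b w m)) <= e * kappa * s).
  { destruct (Rle_lt_or_eq_dec _ _ Hs) as [Hpos|H0].
    - specialize (Hu (fun j => / s * b j)). rewrite !lincomb_scal, !vadd_0_l, !vnorm_scal in Hu.
      rewrite (Rabs_right (/ s)) in Hu by (apply Rle_ge; left; now apply Rinv_0_lt_compat).
      rewrite <- Rmult_minus_distr_l, Rabs_mult in Hu.
      rewrite (Rabs_right (/ s)) in Hu by (apply Rle_ge; left; now apply Rinv_0_lt_compat).
      apply (Rmult_le_reg_l (/ s)); [now apply Rinv_0_lt_compat|].
      replace (/ s * (e * kappa * s)) with (e * kappa) by (field; lra). apply Hu.
      intros j Hj. rewrite Rabs_mult, (Rabs_right (/ s))
        by (apply Rle_ge; left; now apply Rinv_0_lt_compat).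
      apply (Rmult_le_reg_l s); [exact Hpos|].
      replace (s * (/ s * Rabs (b j))) with (Rabs (b j)) by (field; lra).
      rewrite Rmult_1_r. auto.
    - assert (Hb0 : forall j, (j < m)%nat -> b j = 0).
      { intros j Hj. specialize (Hbs j Hj). rewrite <- H0 in Hbs.
        pose proof (Rabs_pos (b j)). apply NNPP. intros Hne. apply Rabs_no_R0 in Hne. lra. }
      rewrite (lincomb_ext b (fun _ => 0) wk wk m Hb0 (fun _ _ => eq_refl)).
      rewrite (lincomb_ext b (fun _ => 0) w w m Hb0 (fun _ _ => eq_refl)).
      rewrite !lincomb_zero, !vnorm_zero, Rminus_0_r, Rabs_R0, <- H0. lra. }
  assert (H' : e * kappa * s <= e * vnorm (lincomb b w m)) by nra.
  apply Rabs_le_inv in H. lra.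
Qed.

(** * Shattered trees and ladders *)

Section Shattering.
Variables A B : Type.
Variable phi : A -> B -> R.
Variable alpha : R.

(* [shatters N D V]: a full binary tree of height [D], whose nodes carry a point [y] and a
   level [r] allowed by [N], is shattered by points of [V] with gap [alpha]. *)
Fixpoint shatters (N : B -> R -> Prop) (D : nat) (V : A -> Prop) : Prop :=
  match D with
  | O => exists x, V x
  | S D => exists y r, N y r /\
      shatters N D (fun x => V x /\ phi x y <= r) /\
      shatters N D (fun x => V x /\ r + alpha <= phi x y)
  end.

Lemma shatters_mono (N N' : B -> R -> Prop) D : (forall y r, N y r -> N' y r) ->
  forall V V' : A -> Prop, (forall x, V x -> V' x) -> shatters N D V -> shatters N' D V'.
Proof.
  intros HN. induction D as [|D IH]; simpl; intros V V' HV.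
  - intros [x Hx]. exists x. auto.
  - intros (y & r & Hy & H1 & H2). exists y, r. split; [auto|].
    split; [revert H1|revert H2]; apply IH; intros x []; auto.
Qed.

Lemma shatters_nonempty N D : forall V, shatters N D V -> exists x, V x.
Proof.
  induction D as [|D IH]; simpl; intros V; [auto|].
  intros (y & r & _ & H & _). destruct (IH _ H) as [x [Hx _]]. now exists x.
Qed.

(** Ramsey property of binary trees: the root joins two trees of its own colour found on both sides,
    unless one side already contains a tall enough tree of the other colour. *)
Lemma shatters_ramsey (N P : B -> R -> Prop) p : forall q V, shatters N (p + q) V ->
  shatters (fun y r => N y r /\ P y r) p V \/ shatters (fun y r => N y r /\ ~ P y r) q V.
Proof.
  induction p as [|p IHp]; [intros q V H; left; exact (shatters_nonempty _ _ _ H)|].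
  induction q as [|q IHq]; intros V H; [right; exact (shatters_nonempty _ _ _ H)|].
  destruct H as (y & r & Hy & H1 & H2).
  destruct (excluded_middle_informative (P y r)) as [HP|HP].
  - destruct (IHp _ _ H1) as [L1|R1].
    2: { right. revert R1. apply shatters_mono; [auto|]. intros x []; auto. }
    destruct (IHp _ _ H2) as [L2|R2].
    2: { right. revert R2. apply shatters_mono; [auto|]. intros x []; auto. }
    left. exists y, r. auto.
  - cbn [Nat.add] in H1, H2.
    rewrite <- plus_n_Sm in H1, H2. change (S (p + q)) with (S p + q)%nat in H1, H2.
    destruct (IHq _ H1) as [L1|R1].
    { left. revert L1. apply shatters_mono; [auto|]. intros x []; auto. }
    destruct (IHq _ H2) as [L2|R2].
    { left. revert L2. apply shatters_mono; [auto|]. intros x []; auto. }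
    right. exists y, r. auto.
Qed.

(* [t i] records on which side of the level [r j] the values [phi (x i) (y j)], [i < j], lie. *)
Definition ladder (N : B -> R -> Prop) (K : nat) (V : A -> Prop)
    (x : nat -> A) (y : nat -> B) (r : nat -> R) (t : nat -> bool) : Prop :=
  (forall i, (i < K)%nat -> V (x i) /\ N (y i) (r i)) /\
  forall i j, (i < j < K)%nat ->
    if t i then r j + alpha / 2 <= phi (x i) (y j) /\ phi (x j) (y i) <= r i
    else phi (x i) (y j) <= r j + alpha / 2 /\ r i + alpha <= phi (x j) (y i).

(** The two summands are the heights asked of the two colours in [shatters_ramsey]; the extra level
    in each is the root that is paired with the branch. *)
Fixpoint ladder_height (K : nat) : nat :=
  match K with O => 1 | S K => S (ladder_height K) + S (ladder_height K) end.

(* Hodges' argument: a branch [x] splits the nodes into those with [phi x] above and below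
   the middle of their gap, one class contains a tall subtree, and the root of this subtree
   is paired with [x]; the construction continues below the root, on the side opposite to [x]. *)
Lemma shatters_ladder K : forall N V, shatters N (ladder_height K) V ->
  exists x y r t, ladder N K V x y r t.
Proof.
  induction K as [|K IH]; intros N V H.
  - destruct H as (y & r & _ & [x _] & _).
    exists (fun _ => x), (fun _ => y), (fun _ => r), (fun _ => true).
    split; intros; lia.
  - destruct (shatters_nonempty _ _ _ H) as [x0 Hx0].
    set (P := fun y r => r + alpha / 2 <= phi x0 y).
    assert (Hext : forall (b : bool) y0 r0 (V' : A -> Prop) (N' : B -> R -> Prop),
      N y0 r0 ->
      (forall x, V' x -> V x /\ if b then phi x y0 <= r0 else r0 + alpha <= phi x y0) ->
      (forall y r, N' y r -> N y r /\ if b then r + alpha / 2 <= phi x0 y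
        else phi x0 y <= r + alpha / 2) ->
      shatters N' (ladder_height K) V' ->
      exists x y r t, ladder N (S K) V x y r t).
    { intros b y0 r0 V' N' Hy0 HV' HN' H'.
      destruct (IH _ _ H') as (x & y & r & t & L1 & L2).
      exists (fun i => match i with O => x0 | S i => x i end),
        (fun i => match i with O => y0 | S i => y i end),
        (fun i => match i with O => r0 | S i => r i end),
        (fun i => match i with O => b | S i => t i end).
      split.
      - intros [|i] Hi; [auto|]. destruct (L1 i ltac:(lia)) as [Hx Hy].
        split; [apply HV', Hx|apply HN', Hy].
      - intros [|i] [|j] Hij; try lia.
        + destruct (L1 j ltac:(lia)) as [Hx Hy].
          destruct (HV' _ Hx) as [_ HV1]. destruct (HN' _ _ Hy) as [_ HN1].
          destruct b; auto.
        + apply L2. lia. }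
    destruct (shatters_ramsey _ P _ _ _ H)
      as [(y0 & r0 & [Hy0 _] & H1 & _)|(y0 & r0 & [Hy0 _] & _ & H1)].
    + refine (Hext true y0 r0 _ _ Hy0 _ _ H1); [auto|]. intros y r [Hy HP]. auto.
    + refine (Hext false y0 r0 _ _ Hy0 _ _ H1); [auto|].
      intros y r [Hy HP]. split; [exact Hy|]. left. now apply Rnot_le_lt.
Qed.

End Shattering.

Arguments shatters {A B}.
Arguments ladder {A B}.

Definition ball_node {Y : Banach} (y : Y) (r : R) : Prop := in_ball y /\ 0 <= r <= 2.

(** Otherwise there are ladders of every length [K], and in the limit along [K] they form an
    infinite ladder in the ultrapower, with levels tending to some [rho]. If the steps of type [T]
    prevail, then [M <= rho < rho + alpha / 2 <= L]; if not,
    [L <= rho + alpha / 2 < rho + alpha <= M]. The ultrapower is stable, being finitely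
    representable in [Y], which forces [L = M]. *)
Lemma superstable_rank (Y : Banach) U alpha :
  superstable Y -> ultrafilter U -> nonprincipal U -> 0 < alpha ->
  exists D, ~ shatters (@dist Y) alpha ball_node D in_ball.
Proof.
  intros HY HU HN Ha. apply NNPP. intros Hno.
  destruct (choice (fun K (s : (nat -> Y) * (nat -> Y) * (nat -> R) * (nat -> bool)) =>
    let '(x, y, r, t) := s in ladder (@dist Y) alpha ball_node K in_ball x y r t)) as [s Hs].
  { intros K. destruct (shatters_ladder _ _ (@dist Y) alpha K ball_node in_ball)
      as (x & y & r & t & H); [|now exists (x, y, r, t)].
    apply NNPP. intros H. apply Hno. now exists (ladder_height K). }
  set (x := fun K => fst (fst (fst (s K)))). set (y := fun K => snd (fst (fst (s K)))).
  set (r := fun K => snd (fst (s K))). set (t := fun K => snd (s K)).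
  assert (HL : forall K, ladder (@dist Y) alpha ball_node K in_ball (x K) (y K) (r K) (t K)).
  { intros K. specialize (Hs K). unfold x, y, r, t. now destruct (s K) as [[[? ?] ?] ?]. }
  clearbody x y r t. clear s Hs Hno.
  (* The [K]-th ladder has no entry [i] when [K <= i]; the filler [vzero] sits at finitely many [K],
     which the limit ignores. *)
  pose (cut := fun (z : nat -> nat -> Y) i K => if Nat.ltb i K then z K i else vzero).
  assert (Hball : forall z, (forall K i, (i < K)%nat -> in_ball (z K i)) ->
    forall i K, vnorm (cut z i K) <= 1).
  { intros z Hz i K. unfold cut. destruct (Nat.ltb_spec i K); [now apply Hz|].
    rewrite vnorm_zero. lra. }
  assert (Hx1 := Hball x (fun K i Hi => proj1 (proj1 (HL K) i Hi))).
  assert (Hy1 := Hball y (fun K i Hi => proj1 (proj2 (proj1 (HL K) i Hi)))).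
  assert (Hxb : forall i, bounded_seq (cut x i)) by (intros i; exists 1; apply Hx1).
  assert (Hyb : forall i, bounded_seq (cut y i)) by (intros i; exists 1; apply Hy1).
  set (E := ultrapower Y U HU).
  set (X := fun i => uclass Y U HU (cut x i) (Hxb i) : E).
  set (Z := fun i => uclass Y U HU (cut y i) (Hyb i) : E).
  assert (Hd : forall i j, ulim U (fun K => dist (cut x i K) (cut y j K)) (dist (X i) (Z j)))
    by (intros; apply ultrapower_dist).
  assert (Hr : forall i, exists L, ulim U (fun K => if Nat.ltb i K then r K i else 0) L).
  { intros i. apply (ulim_exists U HU _ 2). intros K. destruct (Nat.ltb_spec i K) as [Hi|Hi].
    - destruct (proj1 (HL K) i Hi) as [_ [_ H]]. apply Rabs_le. lra.
    - rewrite Rabs_R0. lra. }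
  apply choice in Hr. destruct Hr as [rr Hr].
  assert (Hrr : forall i, 0 <= rr i <= 2).
  { intros i. split.
    - apply (ulim_ge_const U HU _ _ _ (Hr i)). apply (uf_all U HU). intros K.
      destruct (Nat.ltb_spec i K) as [Hi|Hi]; [|lra].
      destruct (proj1 (HL K) i Hi) as [_ [_ H]]. lra.
    - apply (ulim_le_const U HU _ _ _ (Hr i)). apply (uf_all U HU). intros K.
      destruct (Nat.ltb_spec i K) as [Hi|Hi]; [|lra].
      destruct (proj1 (HL K) i Hi) as [_ [_ H]]. lra. }
  assert (HdX : forall i j, Rabs (dist (X i) (Z j)) <= 2).
  { intros i j. rewrite Rabs_right by apply Rle_ge, dist_pos.
    apply (ulim_le_const U HU _ _ _ (Hd i j)). apply (uf_all U HU). intros K.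
    pose proof (dist_le_norms (cut x i K) (cut y j K)).
    pose proof (Hx1 i K). pose proof (Hy1 j K). lra. }
  destruct (ulim_exists U HU rr 2) as [rho Hrho].
  { intros i. apply Rabs_le. destruct (Hrr i). lra. }
  pose (l := fun i => Ulim U (fun j => dist (X i) (Z j))).
  pose (m := fun j => Ulim U (fun i => dist (X i) (Z j))).
  assert (Hl : forall i, ulim U (fun j => dist (X i) (Z j)) (l i)).
  { intros i. apply (Ulim_spec U _ 2 HU). auto. }
  assert (Hm : forall j, ulim U (fun i => dist (X i) (Z j)) (m j)).
  { intros j. apply (Ulim_spec U _ 2 HU). auto. }
  assert (Hbd : forall c v, (forall i, Rabs (c i) <= 2) -> ulim U c v -> Rabs v <= 2).
  { intros c v Hc Hv. apply Rabs_le. split.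
    - apply (ulim_ge_const U HU _ _ _ Hv), (uf_all U HU). intros i.
      specialize (Hc i). apply Rabs_le_inv in Hc. lra.
    - apply (ulim_le_const U HU _ _ _ Hv), (uf_all U HU). intros i.
      specialize (Hc i). apply Rabs_le_inv in Hc. lra. }
  destruct (ulim_exists U HU l 2) as [L HLl]; [intros i; exact (Hbd _ _ (HdX i) (Hl i))|].
  destruct (ulim_exists U HU m 2) as [M HMm].
  { intros j. exact (Hbd _ _ (fun i => HdX i j) (Hm j)). }
  assert (Hbs : forall z Hz (H1 : forall i K, vnorm (cut z i K) <= 1),
    bounded_seq (fun i => uclass Y U HU (cut z i) (Hz i) : E)).
  { intros z Hz H1. exists 1. intros i.
    apply (ulim_le_const U HU (fun K => vnorm (cut z i K))).
    - apply (unorm_spec Y U HU). apply (ucoord_class Y U HU).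
    - apply (uf_all U HU). apply H1. }
  assert (HLM : L = M).
  { apply (HY E (ultrapower_fin_rep Y U HU HN) X Z U U (Hbs x Hxb Hx1) (Hbs y Hyb Hy1)
      HU HN HU HN l L m M); assumption. }
  (* The type of step [i] in the limiting ladder is the one that it has in almost all finite
     ladders. *)
  set (T := fun i => U (fun K => t K i = true)).
  assert (HT1 : forall i j, T i -> (i < j)%nat ->
    rr j + alpha / 2 <= dist (X i) (Z j) /\ dist (X j) (Z i) <= rr i).
  { intros i j Hi Hij. split.
    - apply (ulim_le U HU _ _ _ _ (ulim_plus U HU _ _ _ _ (Hr j) (ulim_const U HU (alpha / 2)))
        (Hd i j)).
      apply (uf_mono2 U HU _ _ _ Hi (uf_gt U HU HN j)). intros K HtK HjK.
      unfold cut. destruct (Nat.ltb_spec i K); [|lia]. destruct (Nat.ltb_spec j K); [|lia].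
      pose proof (proj2 (HL K) i j ltac:(lia)) as H'. rewrite HtK in H'. apply H'.
    - apply (ulim_le U HU _ _ _ _ (Hd j i) (Hr i)).
      apply (uf_mono2 U HU _ _ _ Hi (uf_gt U HU HN j)). intros K HtK HjK.
      unfold cut. destruct (Nat.ltb_spec i K); [|lia]. destruct (Nat.ltb_spec j K); [|lia].
      pose proof (proj2 (HL K) i j ltac:(lia)) as H'. rewrite HtK in H'. apply H'. }
  assert (HT2 : forall i j, ~ T i -> (i < j)%nat ->
    dist (X i) (Z j) <= rr j + alpha / 2 /\ rr i + alpha <= dist (X j) (Z i)).
  { intros i j Hi Hij. apply (uf_not U HU) in Hi. split.
    - apply (ulim_le U HU _ _ _ _ (Hd i j)
        (ulim_plus U HU _ _ _ _ (Hr j) (ulim_const U HU (alpha / 2)))).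
      apply (uf_mono2 U HU _ _ _ Hi (uf_gt U HU HN j)). intros K HtK HjK.
      unfold cut. destruct (Nat.ltb_spec i K); [|lia]. destruct (Nat.ltb_spec j K); [|lia].
      apply Bool.not_true_is_false in HtK.
      pose proof (proj2 (HL K) i j ltac:(lia)) as H'. rewrite HtK in H'. apply H'.
    - apply (ulim_le U HU _ _ _ _ (ulim_plus U HU _ _ _ _ (Hr i) (ulim_const U HU alpha))
        (Hd j i)).
      apply (uf_mono2 U HU _ _ _ Hi (uf_gt U HU HN j)). intros K HtK HjK.
      unfold cut. destruct (Nat.ltb_spec i K); [|lia]. destruct (Nat.ltb_spec j K); [|lia].
      apply Bool.not_true_is_false in HtK.
      pose proof (proj2 (HL K) i j ltac:(lia)) as H'. rewrite HtK in H'. apply H'. }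
  assert (Hrho2 : forall c, ulim U (fun j => rr j + c) (rho + c)).
  { intros c. apply (ulim_plus U HU); [exact Hrho|apply ulim_const, HU]. }
  destruct (excluded_middle_informative (U T)) as [HT|HT]; [|apply (uf_not U HU) in HT].
  - assert (rho + alpha / 2 <= L).
    { apply (ulim_ge_const U HU _ _ _ HLl). apply (uf_mono U HU _ _ HT). intros i Hi.
      apply (ulim_le U HU _ _ _ _ (Hrho2 (alpha / 2)) (Hl i)).
      apply (uf_mono U HU _ _ (uf_gt U HU HN i)). intros j Hij. now apply HT1. }
    assert (M <= rho).
    { apply (ulim_le U HU _ _ _ _ HMm Hrho). apply (uf_mono U HU _ _ HT). intros j Hj.
      apply (ulim_le_const U HU _ _ _ (Hm j)).
      apply (uf_mono U HU _ _ (uf_gt U HU HN j)). intros i Hij. now apply HT1. }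
    lra.
  - assert (L <= rho + alpha / 2).
    { apply (ulim_le_const U HU _ _ _ HLl). apply (uf_mono U HU _ _ HT). intros i Hi.
      apply (ulim_le U HU _ _ _ _ (Hl i) (Hrho2 (alpha / 2))).
      apply (uf_mono U HU _ _ (uf_gt U HU HN i)). intros j Hij. now apply HT2. }
    assert (rho + alpha <= M).
    { apply (ulim_le U HU _ _ _ _ (Hrho2 alpha) HMm). apply (uf_mono U HU _ _ HT). intros j Hj.
      apply (ulim_ge_const U HU _ _ _ (Hm j)).
      apply (uf_mono U HU _ _ (uf_gt U HU HN j)). intros i Hij. now apply HT2. }
    lra.
Qed.

(** * Dyadic averages *)

(* Average over the dyadic block [[a, a + 2^d)], whose halves start at [a] and [a + 2^(d-1)]. *)
Fixpoint avg (d : nat) (f : nat -> R) (a : nat) : R :=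
  match d with O => f a | S d => (avg d f a + avg d f (a + 2 ^ d)) / 2 end.

Definition in_block (d a i : nat) : Prop := (a <= i < a + 2 ^ d)%nat.

Lemma in_block_left d a i : in_block d a i -> in_block (S d) a i.
Proof. unfold in_block. rewrite Nat.pow_succ_r'. lia. Qed.

Lemma in_block_right d a i : in_block d (a + 2 ^ d) i -> in_block (S d) a i.
Proof. unfold in_block. rewrite Nat.pow_succ_r'. lia. Qed.

Lemma avg_le d f g : forall a, (forall i, in_block d a i -> f i <= g i) -> avg d f a <= avg d g a.
Proof.
  induction d as [|d IH]; intros a H; simpl.
  - apply H. unfold in_block. simpl. lia.
  - pose proof (IH a (fun i Hi => H i (in_block_left _ _ _ Hi))).
    pose proof (IH (a + 2 ^ d)%nat (fun i Hi => H i (in_block_right _ _ _ Hi))). lra.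
Qed.

Lemma avg_ext d f g a : (forall i, in_block d a i -> f i = g i) -> avg d f a = avg d g a.
Proof.
  intros H. apply Rle_antisym; apply avg_le; intros i Hi; rewrite (H i Hi); lra.
Qed.

Lemma avg_const d c : forall a, avg d (fun _ => c) a = c.
Proof. induction d as [|d IH]; intros a; simpl; [reflexivity|]. rewrite !IH. lra. Qed.

Lemma avg_plus d f g : forall a, avg d (fun i => f i + g i) a = avg d f a + avg d g a.
Proof. induction d as [|d IH]; intros a; simpl; [reflexivity|]. rewrite !IH. lra. Qed.

Lemma avg_minus d f g : forall a, avg d (fun i => f i - g i) a = avg d f a - avg d g a.
Proof. induction d as [|d IH]; intros a; simpl; [reflexivity|]. rewrite !IH. lra. Qed.

Lemma avg_scal d c f : forall a, avg d (fun i => c * f i) a = c * avg d f a.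
Proof. induction d as [|d IH]; intros a; simpl; [reflexivity|]. rewrite !IH. lra. Qed.

Lemma avg_swap d e (f : nat -> nat -> R) b : forall a,
  avg d (fun i => avg e (fun j => f i j) b) a = avg e (fun j => avg d (fun i => f i j) a) b.
Proof.
  induction d as [|d IH]; intros a; simpl; [reflexivity|].
  rewrite !IH, <- avg_plus. unfold Rdiv. rewrite Rmult_comm, <- avg_scal.
  apply avg_ext. intros. ring.
Qed.

Lemma avg_le_term d f a : exists i, in_block d a i /\ avg d f a <= f i.
Proof.
  revert a. induction d as [|d IH]; intros a; simpl.
  - exists a. unfold in_block. simpl. split; [lia|lra].
  - destruct (IH a) as [i [Hi1 Hi2]]. destruct (IH (a + 2 ^ d)%nat) as [j [Hj1 Hj2]].
    destruct (Rle_dec (f i) (f j)).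
    + exists j. split; [now apply in_block_right|lra].
    + exists i. split; [now apply in_block_left|lra].
Qed.

(* Signed sum of [g e b i] over the blocks [(e, b)] through which one descends from the block
   [(d, a)] to the leaf [i]; the sign is [-] when [i] lies in the left half. *)
Fixpoint path_sum (g : nat -> nat -> nat -> R) (d a i : nat) : R :=
  match d with
  | O => 0
  | S e => if Nat.ltb i (a + 2 ^ e) then - g d a i + path_sum g e a i
           else g d a i + path_sum g e (a + 2 ^ e) i
  end.

Lemma path_sum_left g d a i : in_block d a i ->
  path_sum g (S d) a i = - g (S d) a i + path_sum g d a i.
Proof.
  intros [_ H]. cbn [path_sum]. destruct (Nat.ltb_spec i (a + 2 ^ d)); [reflexivity|lia].
Qed.

Lemma path_sum_right g d a i : in_block d (a + 2 ^ d) i ->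
  path_sum g (S d) a i = g (S d) a i + path_sum g d (a + 2 ^ d) i.
Proof.
  intros [H _]. cbn [path_sum]. destruct (Nat.ltb_spec i (a + 2 ^ d)); [lia|reflexivity].
Qed.

(** The left and right turns act as Rademacher signs. Since [g e b i] is read at the leaf [i] where
    the path ends, the sum carries information; if it did not depend on [i], the mean would
    vanish. *)
Definition tree_sum (g : nat -> nat -> nat -> R) (d a : nat) : R := avg d (path_sum g d a) a.

Lemma tree_sum_S g d a : tree_sum g (S d) a =
  (avg d (g (S d) a) (a + 2 ^ d) - avg d (g (S d) a) a) / 2
  + (tree_sum g d a + tree_sum g d (a + 2 ^ d)) / 2.
Proof.
  unfold tree_sum at 1. cbn [avg].
  rewrite (avg_ext d _ (fun i => path_sum g d a i - g (S d) a i) a).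
  2: { intros i Hi. rewrite path_sum_left by exact Hi. ring. }
  rewrite (avg_ext d _ (fun i => g (S d) a i + path_sum g d (a + 2 ^ d) i) (a + 2 ^ d)).
  2: { intros i Hi. now rewrite path_sum_right by exact Hi. }
  rewrite avg_minus, avg_plus. unfold tree_sum. lra.
Qed.

(** * Exponential moments of path sums *)

Lemma exp_mono x y : x <= y -> exp x <= exp y.
Proof. intros [H| ->]; [left; now apply exp_increasing|lra]. Qed.

Lemma exp_le_inv x : x < 1 -> exp x <= / (1 - x).
Proof.
  intros Hx. pose proof (exp_ineq1_le (- x)) as H. rewrite exp_Ropp in H.
  pose proof (exp_pos x).
  rewrite <- (Rinv_inv (exp x)). apply Rinv_le_contravar; lra.
Qed.

(** A form of Hoeffding's bound with a cheap constant: [exp u <= / (1 - u)] for both signs gives the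
    mean [/ (1 - u ^ 2)]. *)
Lemma cosh_bound u : -1 / 2 <= u <= 1 / 2 -> (exp u + exp (- u)) / 2 <= exp (2 * u ^ 2).
Proof.
  intros Hu. pose proof (exp_le_inv u ltac:(lra)) as H1.
  pose proof (exp_le_inv (- u) ltac:(lra)) as H2.
  assert (Hv : 0 <= u ^ 2 <= 1 / 4) by nra.
  assert (H3 : (/ (1 - u) + / (1 - - u)) / 2 = / (1 - u ^ 2)) by (field; nra).
  assert (H4 : / (1 - u ^ 2) <= 1 + 2 * u ^ 2).
  { apply (Rmult_le_reg_l (1 - u ^ 2)); [lra|]. rewrite Rinv_r by lra. nra. }
  pose proof (exp_ineq1_le (2 * u ^ 2)). lra.
Qed.

Definition indicator {A : Type} (V : A -> Prop) (x : A) : R :=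
  if excluded_middle_informative (V x) then 1 else 0.

Lemma indicator_true {A : Type} (V : A -> Prop) x : V x -> indicator V x = 1.
Proof. intros H. unfold indicator. destruct (excluded_middle_informative _); tauto. Qed.

Lemma indicator_false {A : Type} (V : A -> Prop) x : ~ V x -> indicator V x = 0.
Proof. intros H. unfold indicator. destruct (excluded_middle_informative _); tauto. Qed.

Lemma indicator_pos {A : Type} (V : A -> Prop) x : 0 <= indicator V x <= 1.
Proof. unfold indicator. destruct (excluded_middle_informative _); lra. Qed.

Section ExponentialMoment.
Variables A B : Type.
Variable phi : A -> B -> R.
Variables (V0 : A -> Prop) (W : B -> Prop).
Hypothesis phi_bound : forall x y, V0 x -> W y -> 0 <= phi x y <= 2.
Variables (alpha lam : R).
Hypothesis Halpha : 0 < alpha <= 1.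
Hypothesis Hlam : Rabs lam <= 1 / 4.

Let N (y : B) (r : R) : Prop := W y /\ 0 <= r <= 2.

(* Levels splitting a set of rank at most [D + 1] into two sets of rank at most [D] and a
   set on which [phi _ y] is nearly constant. *)
Lemma rank_split D V y : (forall x, V x -> V0 x) -> W y -> ~ shatters phi alpha N (S D) V ->
  exists r, -1 <= r <= 2 /\ ~ shatters phi alpha N D (fun x => V x /\ phi x y <= r) /\
    ~ shatters phi alpha N D (fun x => V x /\ r + 2 * alpha <= phi x y).
Proof.
  intros HV Hy Hbig.
  assert (H : exists r, -1 <= r /\ ~ shatters phi alpha N D (fun x => V x /\ phi x y <= r) /\
    ~ shatters phi alpha N D (fun x => V x /\ r + 2 * alpha <= phi x y)).
  { apply NNPP. intros Hno.
    (* The level climbs in steps of [alpha] from below the range of [phi]. If the lower set first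
       acquires rank [D] on passing from [r] to [r + alpha], then the set above [r + 2 * alpha]
       cannot have it as well: [y] with level [r + alpha] would be the root of a tree of height
       [S D]. *)
    assert (Hlow : forall n, ~ shatters phi alpha N D
      (fun x => V x /\ phi x y <= INR n * alpha - alpha)).
    { induction n as [|n IH].
      - intros H. destruct (shatters_nonempty _ _ _ _ _ _ _ H) as [x [Hx Hr]].
        pose proof (phi_bound x y (HV x Hx) Hy). simpl in Hr. lra.
      - intros H. apply Hno. exists (INR n * alpha - alpha).
        split; [pose proof (pos_INR n); nra|]. split; [exact IH|].
        intros H'. apply Hbig. exists y, (INR (S n) * alpha - alpha).
        rewrite S_INR in *. repeat split; [exact Hy| | |exact H|].
        + destruct (shatters_nonempty _ _ _ _ _ _ _ H) as [x [Hx Hr]].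
          pose proof (phi_bound x y (HV x Hx) Hy). lra.
        + destruct (shatters_nonempty _ _ _ _ _ _ _ H') as [x [Hx Hr]].
          pose proof (phi_bound x y (HV x Hx) Hy). lra.
        + revert H'. apply shatters_mono; [auto|]. intros x [Hx Hr]. split; [exact Hx|lra]. }
    destruct (INR_unbounded (3 / alpha)) as [n Hn].
    assert (Hna : 3 <= INR n * alpha).
    { left. apply (Rmult_lt_reg_r (/ alpha)); [apply Rinv_0_lt_compat; lra|].
      replace (INR n * alpha * / alpha) with (INR n) by (field; lra). exact Hn. }
    apply Hno. exists (INR n * alpha - alpha). split; [lra|]. split; [apply Hlow|].
    intros H. destruct (shatters_nonempty _ _ _ _ _ _ _ H) as [x [Hx Hr]].
    pose proof (phi_bound x y (HV x Hx) Hy). lra. }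
  destruct H as (r & Hr & H1 & H2).
  (* A level above 2 may be lowered to 2, with no points left above the gap. The bounds on [r] serve
     to get [lam * r] into the range of [cosh_bound]. *)
  destruct (Rle_dec r 2) as [Hr2|Hr2]; [exists r; auto|].
  exists 2. split; [lra|]. split.
  - intros H. apply H1. revert H. apply shatters_mono; [auto|].
    intros x [Hx Hx']. split; [exact Hx|lra].
  - intros H. destruct (shatters_nonempty _ _ _ _ _ _ _ H) as [x [Hx Hx']].
    pose proof (phi_bound x y (HV x Hx) Hy). lra.
Qed.

Variable x : nat -> A.
Variable y : nat -> nat -> B.
Hypothesis Hy : forall d a, W (y d a).

Let g (d a i : nat) : R := phi (x i) (y d a).
(** [growth] is the cost of a level on the set where [phi] is nearly constant: [8 * lam ^ 2] bounds
    the exponent of the cosh at [lam * r], and [2 * Rabs lam * alpha] pays for the variation of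
    [phi]. [branch] collects the crude bounds on the two sets of smaller rank, in both halves of a
    block. *)
Let growth := exp (8 * lam ^ 2 + 2 * Rabs lam * alpha).
Let branch := 2 * exp (2 * Rabs lam).

Let moment d a (V : A -> Prop) : R :=
  avg d (fun i => indicator V (x i) * exp (lam * path_sum g d a i)) a.

(** On the two outer sets a crude bound suffices, because their rank is smaller. In between, the
    contribution of the root is [exp (s * (lam * r))] up to a fixed factor; keeping the sign [s]
    lets the two halves of a block combine into a cosh. *)
Lemma half_moment (s : R) d a V y0 r : (s = 1 \/ s = -1) -> (forall z, V z -> V0 z) -> W y0 ->
  avg d (fun i => indicator V (x i) * exp (lam * (s * phi (x i) y0 + path_sum g d a i))) a
  <= exp (2 * Rabs lam) * moment d a (fun z => V z /\ phi z y0 <= r)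
   + exp (2 * Rabs lam) * moment d a (fun z => V z /\ r + 2 * alpha <= phi z y0)
   + exp (2 * Rabs lam * alpha) * exp (s * (lam * r)) * moment d a V.
Proof.
  intros Hs HV Hy0. unfold moment. rewrite <- !avg_scal, <- !avg_plus.
  apply avg_le. intros i _.
  set (z := x i). set (S := path_sum g d a i).
  rewrite Rmult_plus_distr_l, exp_plus.
  set (E := exp (lam * S)). assert (HE : 0 < E) by apply exp_pos.
  destruct (excluded_middle_informative (V z)) as [HVz|HVz].
  2: { rewrite !(indicator_false V z HVz), !indicator_false by tauto. lra. }
  rewrite !(indicator_true V z HVz).
  pose proof (phi_bound z y0 (HV z HVz) Hy0) as Hp.
  set (lo := indicator _ z). set (hi := indicator _ z).
  assert (Hlo : 0 <= lo) by apply indicator_pos.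
  assert (Hhi : 0 <= hi) by apply indicator_pos.
  assert (Hc : exp (lam * (s * phi z y0)) <= exp (2 * Rabs lam)).
  { apply exp_mono. pose proof (Rle_abs lam). pose proof (Rle_abs (- lam)).
    rewrite Rabs_Ropp in *. destruct Hs as [-> | ->]; nra. }
  pose proof (exp_pos (2 * Rabs lam)) as He1.
  pose proof (exp_pos (2 * Rabs lam * alpha)) as He2.
  pose proof (exp_pos (s * (lam * r))) as He3.
  assert (Hprod : 0 < exp (2 * Rabs lam * alpha) * exp (s * (lam * r)))
    by now apply Rmult_lt_0_compat.
  assert (Key : exp (lam * (s * phi z y0)) <= exp (2 * Rabs lam) * lo + exp (2 * Rabs lam) * hi
    + exp (2 * Rabs lam * alpha) * exp (s * (lam * r))).
  { destruct (Rle_dec (phi z y0) r) as [H1|H1].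
    { unfold lo. rewrite indicator_true by tauto. nra. }
    destruct (Rle_dec (r + 2 * alpha) (phi z y0)) as [H2|H2].
    { unfold hi. rewrite indicator_true by tauto. nra. }
    assert (exp (lam * (s * phi z y0)) <= exp (2 * Rabs lam * alpha) * exp (s * (lam * r)));
      [|nra].
    rewrite <- exp_plus. apply exp_mono.
    pose proof (Rle_abs lam). pose proof (Rle_abs (- lam)).
    rewrite Rabs_Ropp in *. destruct Hs as [-> | ->]; nra. }
  nra.
Qed.

(** As in the Sauer-Shelah lemma, the moments obey a recursion of Pascal type, [m (S d) (S D) <=
    branch * m d D + growth * m d (S D)]. It is solved by [growth ^ d] times a polynomial of degree
    [D] in [d]; rank 0 means that [V] is empty. *)
Lemma moment_bound d : forall a D V, (forall z, V z -> V0 z) -> ~ shatters phi alpha N D V ->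
  moment d a V <= growth ^ d * (1 + branch * INR d) ^ D.
Proof.
  assert (Hg1 : 1 <= growth).
  { unfold growth. rewrite <- exp_0. apply exp_mono.
    pose proof (Rabs_pos lam). nra. }
  assert (Hb0 : 0 <= branch) by (unfold branch; pose proof (exp_pos (2 * Rabs lam)); lra).
  induction d as [|d IH]; intros a D V HV HD.
  - unfold moment. cbn [avg path_sum pow INR].
    rewrite !Rmult_0_r, Rplus_0_r, pow1, exp_0.
    pose proof (indicator_pos V (x a)). lra.
  - assert (Hg : 0 <= growth ^ d) by (apply pow_le; lra).
    pose proof (pos_INR d) as HdR.
    destruct D as [|D].
    { unfold moment. rewrite (avg_ext _ _ (fun _ => 0)).
      2: { intros i _. rewrite indicator_false; [ring|]. intros H. apply HD. now exists (x i). }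
      rewrite avg_const. simpl pow. rewrite Rmult_1_r.
      apply Rmult_le_pos; [lra|exact Hg]. }
    destruct (rank_split D V (y (S d) a) HV (Hy _ _) HD) as (r & Hr & Hlo & Hhi).
    unfold moment. cbn [avg].
    rewrite (avg_ext d _ (fun i => indicator V (x i) *
      exp (lam * (-1 * phi (x i) (y (S d) a) + path_sum g d a i))) a).
    2: { intros i Hi. rewrite path_sum_left by exact Hi. unfold g at 1. do 3 f_equal. ring. }
    rewrite (avg_ext d _ (fun i => indicator V (x i) *
      exp (lam * (1 * phi (x i) (y (S d) a) + path_sum g d (a + 2 ^ d) i))) (a + 2 ^ d)).
    2: { intros i Hi. rewrite path_sum_right by exact Hi. unfold g at 1. do 3 f_equal. ring. }
    pose proof (half_moment (-1) d a V (y (S d) a) r (or_intror eq_refl) HV (Hy _ _)) as HL.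
    pose proof (half_moment 1 d (a + 2 ^ d) V (y (S d) a) r (or_introl eq_refl) HV (Hy _ _)) as HR.
    set (p := 1 + branch * INR d).
    assert (Hp : 1 <= p) by (unfold p; nra).
    set (G0 := growth ^ d * p ^ D). set (G1 := growth ^ d * p ^ S D).
    assert (HG0 : 0 <= G0) by (apply Rmult_le_pos; [exact Hg|apply pow_le; lra]).
    assert (HG1 : 0 <= G1) by (apply Rmult_le_pos; [exact Hg|apply pow_le; lra]).
    assert (Hlow : forall b, moment d b (fun z => V z /\ phi z (y (S d) a) <= r) <= G0).
    { intros b. apply IH; [intros z []; auto|exact Hlo]. }
    assert (Hhigh : forall b, moment d b (fun z => V z /\ r + 2 * alpha <= phi z (y (S d) a)) <= G0).
    { intros b. apply IH; [intros z []; auto|exact Hhi]. }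
    assert (Hmid : forall b, moment d b V <= G1) by (intros b; now apply IH).
    set (M1 := moment d a (fun z => V z /\ phi z (y (S d) a) <= r)) in *.
    set (M2 := moment d a (fun z => V z /\ r + 2 * alpha <= phi z (y (S d) a))) in *.
    set (M3 := moment d (a + 2 ^ d) (fun z => V z /\ phi z (y (S d) a) <= r)) in *.
    set (M4 := moment d (a + 2 ^ d) (fun z => V z /\ r + 2 * alpha <= phi z (y (S d) a))) in *.
    assert (HM1 : M1 <= G0) by apply Hlow. assert (HM2 : M2 <= G0) by apply Hhigh.
    assert (HM3 : M3 <= G0) by apply Hlow. assert (HM4 : M4 <= G0) by apply Hhigh.
    pose proof (Hmid a) as HM5. pose proof (Hmid (a + 2 ^ d)%nat) as HM6.
    set (e := exp (2 * Rabs lam)) in *. assert (He : 0 < e) by apply exp_pos.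
    set (e' := exp (2 * Rabs lam * alpha)) in *. assert (He' : 0 < e') by apply exp_pos.
    assert (Hcosh : e' * ((exp (1 * (lam * r)) + exp (-1 * (lam * r))) / 2) <= growth).
    { assert (Hrl : -1 / 2 <= lam * r <= 1 / 2).
      { apply Rabs_le_inv in Hlam. nra. }
      pose proof (cosh_bound (lam * r) Hrl) as H.
      rewrite Rmult_1_l. replace (-1 * (lam * r)) with (- (lam * r)) by ring.
      unfold growth. rewrite exp_plus, Rmult_comm. unfold e'.
      apply Rmult_le_compat_r; [left; apply exp_pos|]. eapply Rle_trans; [exact H|].
      apply exp_mono. assert (r ^ 2 <= 4) by nra. assert (0 <= lam ^ 2) by nra.
      replace ((lam * r) ^ 2) with (lam ^ 2 * r ^ 2) by ring. nra. }
    set (c1 := exp (1 * (lam * r))) in *. set (c2 := exp (-1 * (lam * r))) in *.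
    assert (Hc1 : 0 < c1) by apply exp_pos. assert (Hc2 : 0 < c2) by apply exp_pos.
    assert (T1 : e' * c2 * moment d a V <= e' * c2 * G1).
    { apply Rmult_le_compat_l; [nra|exact HM5]. }
    assert (T2 : e' * c1 * moment d (a + 2 ^ d) V <= e' * c1 * G1).
    { apply Rmult_le_compat_l; [nra|exact HM6]. }
    assert (T3 : e' * ((c1 + c2) / 2) * G1 <= growth * G1) by now apply Rmult_le_compat_r.
    apply (Rle_trans _ (branch * G0 + growth * G1)).
    { unfold branch. fold e.
      assert (e * M1 <= e * G0) by (apply Rmult_le_compat_l; lra).
      assert (e * M2 <= e * G0) by (apply Rmult_le_compat_l; lra).
      assert (e * M3 <= e * G0) by (apply Rmult_le_compat_l; lra).
      assert (e * M4 <= e * G0) by (apply Rmult_le_compat_l; lra).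
      lra. }
    rewrite S_INR. replace (1 + branch * (INR d + 1)) with (p + branch) by (unfold p; ring).
    assert (Hpow : p ^ D <= (p + branch) ^ D) by (apply pow_incr; lra).
    assert (0 <= p ^ D) by (apply pow_le; lra).
    apply (Rle_trans _ (growth ^ S d * (p ^ D * (p + branch)))).
    { assert (Hbg : 0 <= branch * G0) by now apply Rmult_le_pos.
      replace (growth ^ S d * (p ^ D * (p + branch))) with (growth * G1 + growth * (branch * G0))
        by (unfold G0, G1; simpl; ring).
      nra. }
    apply Rmult_le_compat_l; [apply pow_le; lra|]. simpl. nra.
Qed.

End ExponentialMoment.

(** * From exponential moments to small tree sums *)

Lemma log_small (b kappa : R) (D : nat) : 0 <= b -> 0 < kappa ->
  exists d, (1 <= d)%nat /\ INR D * ln (1 + b * INR d) <= kappa * INR d.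
Proof.
  intros Hb Hk.
  destruct (INR_unbounded (4 * INR D ^ 2 * (1 + b) / kappa ^ 2)) as [n Hn].
  set (d := S n). exists d. split; [unfold d; lia|].
  assert (Hd1 : 1 <= INR d) by (unfold d; rewrite S_INR; pose proof (pos_INR n); lra).
  assert (Hd : 4 * INR D ^ 2 * (1 + b) <= kappa ^ 2 * INR d).
  { apply (Rmult_le_reg_r (/ kappa ^ 2)); [apply Rinv_0_lt_compat; nra|].
    replace (kappa ^ 2 * INR d * / kappa ^ 2) with (INR d) by (field; lra).
    unfold d. rewrite S_INR. unfold Rdiv in Hn. lra. }
  (* Writing the argument as a square and using [ln u <= u] replaces the logarithm by a square root,
     still small against [d]. *)
  set (u := sqrt (1 + b * INR d)).
  assert (Hu1 : 1 + b * INR d = u * u) by (unfold u; rewrite sqrt_sqrt; nra).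
  assert (Hu : 0 < u) by (apply sqrt_lt_R0; nra).
  rewrite Hu1, ln_mult by exact Hu.
  assert (Hln : ln u <= u).
  { pose proof (exp_ineq1_le (ln u)). rewrite exp_ln in H by exact Hu. lra. }
  pose proof (pos_INR D) as HD.
  apply (Rle_trans _ (2 * INR D * u)); [nra|].
  apply Rsqr_incr_0_var; [|nra]. unfold Rsqr.
  replace (2 * INR D * u * (2 * INR D * u)) with (4 * INR D ^ 2 * (u * u)) by ring.
  rewrite <- Hu1.
  apply (Rle_trans _ (4 * INR D ^ 2 * (1 + b) * INR d)).
  - assert (0 <= 4 * INR D ^ 2) by nra.
    assert (1 + b * INR d <= (1 + b) * INR d) by nra. nra.
  - assert (4 * INR D ^ 2 * (1 + b) * INR d <= kappa ^ 2 * INR d * INR d)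
      by (apply Rmult_le_compat_r; lra). lra.
Qed.

(** Jensen's inequality for [exp], from its tangent line at 0. *)
Lemma avg_exp_le d f a K : avg d (fun i => exp (f i)) a <= exp K -> avg d f a <= K.
Proof.
  intros H.
  assert (Hle : avg d (fun i => f i - K) a <= avg d (fun i => exp (- K) * exp (f i) - 1) a).
  { apply avg_le. intros i _. rewrite <- exp_plus.
    pose proof (exp_ineq1_le (- K + f i)). lra. }
  rewrite !avg_minus, avg_scal, !avg_const in Hle.
  assert (exp (- K) * avg d (fun i => exp (f i)) a <= exp (- K) * exp K).
  { apply Rmult_le_compat_l; [left; apply exp_pos|exact H]. }
  rewrite <- exp_plus in H0. replace (- K + K) with 0 in H0 by ring. rewrite exp_0 in H0. lra.
Qed.

Lemma ball_dist {Y : Banach} (x y : Y) : in_ball x -> in_ball y -> 0 <= dist x y <= 2.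
Proof.
  unfold in_ball. intros Hx Hy. pose proof (dist_pos x y). pose proof (dist_le_norms x y). lra.
Qed.

Lemma tree_sum_small (Y : Banach) U : superstable Y -> ultrafilter U -> nonprincipal U ->
  forall eta, 0 < eta <= 1 -> exists d, (1 <= d)%nat /\
  forall (x : nat -> Y) (y : nat -> nat -> Y),
    (forall i, in_ball (x i)) -> (forall e b, in_ball (y e b)) ->
    Rabs (tree_sum (fun e b i => dist (x i) (y e b)) d 0) <= eta * INR d.
Proof.
  intros HY HU HN eta Heta.
  destruct (superstable_rank Y U (eta / 8) HY HU HN ltac:(lra)) as [D HD].
  (* With [alpha = eta / 8] and [Rabs lam = l], the exponent of [growth] is exactly [l * eta / 2].
     The other half of [l * eta] per level pays for the logarithm of the polynomial factor. *)
  set (l := eta / 32).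
  destruct (log_small (2 * exp (2 * l)) (l * eta / 2) D) as [d [Hd1 Hd]].
  { pose proof (exp_pos (2 * l)). lra. }
  { unfold l. nra. }
  exists d. split; [exact Hd1|]. intros x y Hx Hy.
  assert (H : forall lam, Rabs lam = l ->
    lam * tree_sum (fun e b i => dist (x i) (y e b)) d 0 <= l * (eta * INR d)).
  { intros lam Hlam. unfold tree_sum. rewrite <- avg_scal.
    apply avg_exp_le.
    pose proof (moment_bound Y Y dist in_ball in_ball ball_dist (eta / 8) lam ltac:(lra)
      ltac:(rewrite Hlam; unfold l; lra) x y Hy d 0 D in_ball (fun z Hz => Hz) HD) as HM.
    cbv beta zeta in HM.
    rewrite (avg_ext _ _ (fun i => exp (lam * path_sum (fun e b i => dist (x i) (y e b)) d 0 i)))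
      in HM by (intros i _; rewrite indicator_true by apply Hx; ring).
    eapply Rle_trans; [exact HM|]. rewrite Hlam.
    pose proof (exp_pos (2 * l)). pose proof (pos_INR d).
    replace ((1 + 2 * exp (2 * l) * INR d) ^ D)
      with (exp (INR D * ln (1 + 2 * exp (2 * l) * INR d))).
    2: { rewrite <- Rpower_pow by nra. reflexivity. }
    rewrite <- (Rpower_pow d) by apply exp_pos. unfold Rpower. rewrite ln_exp, <- exp_plus.
    apply exp_mono.
    assert (El : lam ^ 2 = l ^ 2) by (rewrite <- Hlam; symmetry; apply pow2_abs).
    rewrite El.
    replace (8 * l ^ 2 + 2 * l * (eta / 8)) with (l * eta / 2) by (unfold l; field). lra. }
  assert (Hl : 0 < l) by (unfold l; lra).
  pose proof (H l ltac:(apply Rabs_right; lra)) as H1.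
  pose proof (H (- l) ltac:(rewrite Rabs_Ropp; apply Rabs_right; lra)) as H2.
  apply Rabs_le. split; apply (Rmult_le_reg_l l); lra.
Qed.

(** * Asymmetry of the distance kernel *)

(* Sum over the [d] scales of the mean of [psi i j], where a block of this scale is drawn at
   random, and [i], [j] are drawn independently from its left and right halves. *)
Fixpoint node_sum (psi : nat -> nat -> R) (d a : nat) : R :=
  match d with
  | O => 0
  | S e => avg e (fun i => avg e (fun j => psi i j) (a + 2 ^ e)) a
           + (node_sum psi e a + node_sum psi e (a + 2 ^ e)) / 2
  end.

Lemma node_sum_scal c psi d : forall a,
  node_sum (fun i j => c * psi i j) d a = c * node_sum psi d a.
Proof.
  induction d as [|d IH]; intros a; simpl; [ring|].
  rewrite !IH, (avg_ext _ _ (fun i => c * avg d (fun j => psi i j) (a + 2 ^ d))).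
  - rewrite avg_scal. lra.
  - intros i _. apply avg_scal.
Qed.

Lemma node_sum_plus psi psi' d : forall a,
  node_sum (fun i j => psi i j + psi' i j) d a = node_sum psi d a + node_sum psi' d a.
Proof.
  induction d as [|d IH]; intros a; simpl; [ring|].
  rewrite !IH, (avg_ext _ _ (fun i => avg d (fun j => psi i j) (a + 2 ^ d)
    + avg d (fun j => psi' i j) (a + 2 ^ d))).
  - rewrite avg_plus. lra.
  - intros i _. apply avg_plus.
Qed.

Lemma node_sum_rsum (psi : nat -> nat -> nat -> R) n d a :
  node_sum (fun i j => rsum (fun k => psi k i j) n) d a = rsum (fun k => node_sum (psi k) d a) n.
Proof.
  induction n as [|n IH]; simpl; [|now rewrite node_sum_plus, IH].
  revert a. induction d as [|d IHd]; intros a; simpl; [reflexivity|].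
  rewrite !IHd, (avg_ext _ _ (fun _ => 0)) by (intros; apply avg_const).
  rewrite avg_const. lra.
Qed.

Lemma node_sum_ge psi c d : forall a,
  (forall i j, in_block d a i -> in_block d a j -> (i < j)%nat -> c <= psi i j) ->
  c * INR d <= node_sum psi d a.
Proof.
  induction d as [|d IH]; intros a H; [simpl; lra|].
  rewrite S_INR. cbn [node_sum].
  assert (H1 : c <= avg d (fun i => avg d (fun j => psi i j) (a + 2 ^ d)) a).
  { rewrite <- (avg_const d c a). apply avg_le. intros i Hi.
    rewrite <- (avg_const d c (a + 2 ^ d)). apply avg_le. intros j Hj.
    apply H; [now apply in_block_left|now apply in_block_right|].
    unfold in_block in *. lia. }
  pose proof (IH a (fun i j Hi Hj => H i j (in_block_left _ _ _ Hi) (in_block_left _ _ _ Hj))).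
  pose proof (IH (a + 2 ^ d)%nat
    (fun i j Hi Hj => H i j (in_block_right _ _ _ Hi) (in_block_right _ _ _ Hj))).
  lra.
Qed.

(* Unlike [dist x y], this is bounded by [2 * min (vnorm x) (vnorm y)]. *)
Definition kernel {Y : Banach} (x y : Y) : R := dist x y - vnorm x - vnorm y.

Lemma kernel_bound {Y : Banach} (x y : Y) :
  Rabs (kernel x y) <= 2 * vnorm x /\ Rabs (kernel x y) <= 2 * vnorm y.
Proof.
  unfold kernel. pose proof (dist_le_norms x y).
  pose proof (vnorm_le_dist x y). pose proof (vnorm_le_dist y x).
  rewrite (dist_sym y x) in *. pose proof (vnorm_pos x). pose proof (vnorm_pos y).
  split; apply Rabs_le; lra.
Qed.

Lemma kernel_0_l {Y : Banach} (y : Y) : kernel vzero y = 0.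
Proof. unfold kernel. rewrite dist_0_l, vnorm_zero. ring. Qed.

Lemma kernel_0_r {Y : Banach} (x : Y) : kernel x vzero = 0.
Proof. unfold kernel. rewrite dist_0_r, vnorm_zero. ring. Qed.

Lemma kernel_scal {Y : Banach} c (x y : Y) : 0 <= c ->
  kernel (vscal c x) (vscal c y) = c * kernel x y.
Proof.
  intros Hc. unfold kernel. rewrite dist_scal, !vnorm_scal, Rabs_right by lra. ring.
Qed.

Lemma avg_kernel {Y : Banach} (x : nat -> Y) y d a :
  avg d (fun i => kernel (x i) y) a
  = avg d (fun i => dist (x i) y) a - avg d (fun i => dist (x i) vzero) a - vnorm y.
Proof.
  unfold kernel. rewrite !avg_minus, avg_const. do 2 f_equal.
  apply avg_ext. intros. symmetry. apply dist_0_r.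
Qed.

Lemma kernel_sym {Y : Banach} (x y : Y) : kernel x y = kernel y x.
Proof. unfold kernel. rewrite dist_sym. ring. Qed.

Definition asymmetry {Y : Banach} (x y : nat -> Y) (i j : nat) : R :=
  kernel (x i) (y j) - kernel (x j) (y i).

(* Comparing both halves [L], [R] of a block with [R], one bounds the asymmetry by differences
   of the means over [L] and [R] of the distance to one well chosen point. *)
Lemma node_sum_tree {Y : Banach} (x y : nat -> Y) : exists s t : nat -> nat -> nat,
  forall d a, node_sum (asymmetry x y) d a <=
    - 2 * tree_sum (fun e b i => dist (x i) (y (s e b))) d a
    + 2 * tree_sum (fun e b i => dist (x i) vzero) d a
    + 2 * tree_sum (fun e b i => dist (y i) (x (t e b))) d a
    - 2 * tree_sum (fun e b i => dist (y i) vzero) d a.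
Proof.
  (* The points are selected for all blocks at once. A block with halves of height [d] has height
     [S d], the index under which [tree_sum_S] reads its node. *)
  assert (Hsel : forall f : nat -> nat -> nat -> R, exists s : nat -> nat -> nat,
    forall d a, avg d (f d a) (a + 2 ^ d) <= f d a (s (S d) a)).
  { intros f. destruct (choice (fun (p : nat * nat) i =>
      avg (pred (fst p)) (f (pred (fst p)) (snd p)) (snd p + 2 ^ pred (fst p))
        <= f (pred (fst p)) (snd p) i)) as [s Hs].
    - intros [d a]. simpl. destruct (avg_le_term (pred d) (f (pred d) a) (a + 2 ^ pred d))
        as [i [_ Hi]]. now exists i.
    - exists (fun d a => s (d, a)). intros d a. exact (Hs (S d, a)). }
  destruct (Hsel (fun d a j => avg d (fun i => kernel (x i) (y j)) a
    - avg d (fun i => kernel (x i) (y j)) (a + 2 ^ d))) as [s Hs].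
  destruct (Hsel (fun d a i => avg d (fun j => kernel (y j) (x i)) (a + 2 ^ d)
    - avg d (fun j => kernel (y j) (x i)) a)) as [t Ht].
  exists s, t. induction d as [|d IH]; intros a.
  - unfold tree_sum. simpl. lra.
  - rewrite !tree_sum_S. cbn [node_sum].
    pose proof (IH a) as IH1. pose proof (IH (a + 2 ^ d)%nat) as IH2.
    specialize (Hs d a). specialize (Ht d a).
    rewrite avg_minus, !avg_kernel in Hs. rewrite avg_minus, !avg_kernel in Ht.
    assert (E : avg d (fun i => avg d (asymmetry x y i) (a + 2 ^ d)) a
      = avg d (fun j => avg d (fun i => kernel (x i) (y j)) a) (a + 2 ^ d)
        - avg d (fun j => avg d (fun i => kernel (y i) (x j)) a) (a + 2 ^ d)).
    { rewrite avg_swap, <- avg_minus. apply avg_ext. intros j _. rewrite <- avg_minus.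
      apply avg_ext. intros i _. unfold asymmetry. now rewrite (kernel_sym (y i)). }
    (* The mean over the right half in both indices is inserted between the two terms of [E]. It is
       read once as a mean over the [x i] and once over the [y j], to match the two selected
       points. *)
    assert (E2 : avg d (fun j => avg d (fun i => kernel (x i) (y j)) (a + 2 ^ d)) (a + 2 ^ d)
      = avg d (fun i => avg d (fun j => kernel (y j) (x i)) (a + 2 ^ d)) (a + 2 ^ d)).
    { rewrite avg_swap. apply avg_ext. intros i _. apply avg_ext. intros j _. apply kernel_sym. }
    change (fun j => asymmetry x y ?i j) with (asymmetry x y i). lra.
Qed.

Lemma node_sum_small (Y : Banach) U : superstable Y -> ultrafilter U -> nonprincipal U ->
  forall eta, 0 < eta <= 1 -> exists d, (1 <= d)%nat /\
  forall rho (x y : nat -> Y),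
    (forall i, vnorm (x i) <= rho) -> (forall i, vnorm (y i) <= rho) ->
    node_sum (asymmetry x y) d 0 <= eta * rho * INR d.
Proof.
  intros HY HU HN eta Heta.
  (* [node_sum_tree] involves four tree sums, each with coefficient 2 in absolute value. *)
  destruct (tree_sum_small Y U HY HU HN (eta / 8) ltac:(lra)) as [d [Hd1 Hd]].
  exists d. split; [exact Hd1|].
  assert (H0 : in_ball (vzero : Y)) by (unfold in_ball; rewrite vnorm_zero; lra).
  assert (Hunit : forall x y : nat -> Y, (forall i, in_ball (x i)) -> (forall i, in_ball (y i)) ->
    node_sum (asymmetry x y) d 0 <= eta * INR d).
  { intros x y Hx Hy. destruct (node_sum_tree x y) as (s & t & H). specialize (H d O).
    pose proof (Rabs_le_inv _ _ (Hd x (fun e b => y (s e b)) Hx (fun e b => Hy _))).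
    pose proof (Rabs_le_inv _ _ (Hd x (fun e b => vzero) Hx (fun e b => H0))).
    pose proof (Rabs_le_inv _ _ (Hd y (fun e b => x (t e b)) Hy (fun e b => Hx _))).
    pose proof (Rabs_le_inv _ _ (Hd y (fun e b => vzero) Hy (fun e b => H0))).
    lra. }
  intros rho x y Hx Hy.
  assert (Hpos : forall r, 0 < r -> rho <= r -> node_sum (asymmetry x y) d 0 <= eta * r * INR d).
  { intros r Hr Hrho.
    assert (Hin : forall z : Y, vnorm z <= rho -> in_ball (vscal (/ r) z)).
    { intros z Hz. unfold in_ball. rewrite vnorm_scal, Rabs_right
        by (apply Rle_ge; left; now apply Rinv_0_lt_compat).
      apply (Rmult_le_reg_l r); [exact Hr|].
      replace (r * (/ r * vnorm z)) with (vnorm z) by (field; lra). lra. }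
    pose proof (Hunit (fun i => vscal (/ r) (x i)) (fun i => vscal (/ r) (y i))
      (fun i => Hin _ (Hx i)) (fun i => Hin _ (Hy i))) as H.
    replace (asymmetry (fun i => vscal (/ r) (x i)) (fun i => vscal (/ r) (y i)))
      with (fun i j => / r * asymmetry x y i j) in H.
    - rewrite node_sum_scal in H. apply Rmult_le_compat_l with (r := r) in H; [|lra].
      replace (r * (/ r * node_sum (asymmetry x y) d 0)) with (node_sum (asymmetry x y) d 0)
        in H by (field; lra). lra.
    - apply functional_extensionality; intros i. apply functional_extensionality; intros j.
      unfold asymmetry.
      rewrite !kernel_scal by (left; now apply Rinv_0_lt_compat). ring. }
  destruct (Rle_lt_or_eq_dec 0 rho) as [Hr|<-].
  - pose proof (vnorm_pos (x O)). specialize (Hx O). lra.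
  - apply Hpos; lra.
  (* For [rho = 0] rescaling by [rho] is impossible, but every positive radius is admissible and may
     tend to 0. *)
  - apply le_epsilon. intros e He. pose proof (pos_INR d) as Hdp.
    assert (Hd0 : 0 < INR d) by (apply lt_0_INR; lia).
    specialize (Hpos (e / INR d / eta)).
    replace (eta * (e / INR d / eta) * INR d) with e in Hpos by (field; lra).
    replace (eta * 0 * INR d + e) with e by ring.
    assert (0 < e / INR d / eta) by (apply Rdiv_lt_0_compat; [apply Rdiv_lt_0_compat|]; lra).
    apply Hpos; lra.
Qed.

(** * Ladders in finite l1-sums *)

(** Dependent choice in which the whole history is remembered, as a new term has to fit all the
    earlier ones. *)
Lemma sequence_extraction {T : Type} (P : T -> Prop) (Q : T -> T -> Prop) :
  (forall L : list T, Forall P L -> exists y, P y /\ Forall (fun x => Q x y) L) ->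
  exists s : nat -> T, (forall n, P (s n)) /\ (forall n m, (n < m)%nat -> Q (s n) (s m)).
Proof.
  intros H.
  destruct (choice (fun (L : list T) y => Forall P L -> P y /\ Forall (fun x => Q x y) L))
    as [next Hnext].
  { intros L. destruct (excluded_middle_informative (Forall P L)) as [HL|HL].
    - destruct (H L HL) as [y Hy]. now exists y.
    - destruct (H nil (Forall_nil _)) as [y _]. exists y. tauto. }
  pose (hist := fix hist n := match n with
    | O => nil | S k => next (hist k) :: hist k end).
  assert (HP : forall n, Forall P (hist n)).
  { induction n as [|n IH]; simpl; constructor; [|exact IH]. now apply Hnext. }
  exists (fun n => next (hist n)). split; [intros n; now apply Hnext|].
  intros n m Hnm.
  assert (Hin : In (next (hist n)) (hist m)).
  { induction Hnm as [|m _ IH]; simpl; auto. }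
  destruct (Hnext (hist m) (HP m)) as [_ HQ].
  exact (proj1 (Forall_forall _ _) HQ _ Hin).
Qed.

Lemma uf_forall_list (U : (nat -> Prop) -> Prop) {T : Type} (HU : ultrafilter U)
    (Q : T -> nat -> Prop) (L : list T) :
  Forall (fun x => U (Q x)) L -> U (fun n => Forall (fun x => Q x n) L).
Proof.
  induction 1 as [|x L Hx _ IH]; [apply (uf_all U HU); constructor|].
  apply (uf_mono2 U HU _ _ _ Hx IH). intros n H1 H2. now constructor.
Qed.

(* If [h] exceeds [lam * H], the smaller of [h] and [h'] is either at most [2 * H], which is
   small compared to [h], or both [h] and [h'] are at most twice their excess over [H]. *)
Lemma kernel_truncation {Y : Banach} (x y : Y) h h' H lam :
  vnorm x <= h -> vnorm y <= h' -> 0 <= H -> 2 <= lam ->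
  Rabs (kernel x y - kernel (if Rle_dec h (lam * H) then x else vzero)
                            (if Rle_dec h' (lam * H) then y else vzero))
  <= 4 * (h + h') / lam + 4 * Rmin (Rmax h H - H) (Rmax h' H - H).
Proof.
  intros Hx Hy HH Hlam. destruct (kernel_bound x y) as [K1 K2].
  pose proof (vnorm_pos x). pose proof (vnorm_pos y).
  assert (Hmin : Rabs (kernel x y) <= 2 * Rmin h h') by (unfold Rmin; destruct (Rle_dec h h'); lra).
  set (q := h / lam). set (q' := h' / lam).
  replace (4 * (h + h') / lam) with (4 * q + 4 * q') by (unfold q, q'; field; lra).
  assert (Eh : h = q * lam) by (unfold q; field; lra).
  assert (Eh' : h' = q' * lam) by (unfold q'; field; lra).
  assert (0 <= q) by (apply Rdiv_nonneg; lra).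
  assert (0 <= q') by (apply Rdiv_nonneg; lra).
  assert (He : 0 <= Rmax h H - H) by (pose proof (Rmax_r h H); lra).
  assert (He' : 0 <= Rmax h' H - H) by (pose proof (Rmax_r h' H); lra).
  assert (Hm0 : 0 <= Rmin (Rmax h H - H) (Rmax h' H - H)) by now apply Rmin_glb.
  assert (Hexc : q >= H \/ q' >= H -> 2 * Rmin h h' <=
    4 * q + 4 * q' + 4 * Rmin (Rmax h H - H) (Rmax h' H - H)).
  { intros Hq. pose proof (Rmin_l h h') as M1. pose proof (Rmin_r h h') as M2.
    destruct (Rle_dec (Rmin h h') (2 * H)) as [Hs|Hs]; [lra|].
    assert (Rmin h h' <= 2 * Rmin (Rmax h H - H) (Rmax h' H - H)); [|lra].
    rewrite (Rmax_left h), (Rmax_left h') by lra.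
    unfold Rmin at 2. destruct (Rle_dec _ _); lra. }
  destruct (Rle_dec h (lam * H)) as [Hh|Hh]; [destruct (Rle_dec h' (lam * H)) as [Hh'|Hh']|].
  - rewrite Rminus_diag, Rabs_R0. lra.
  - rewrite kernel_0_r, Rminus_0_r. assert (q' >= H) by nra. lra.
  - rewrite kernel_0_l, Rminus_0_r. assert (q >= H) by nra. lra.
Qed.

Section Ladders.
Variable Y : Banach.
Variable U : (nat -> Prop) -> Prop.
Hypothesis HY : superstable Y.
Hypothesis HU : ultrafilter U.
Hypothesis HN : nonprincipal U.

Variables gam M : R.
Hypothesis Hgam : 0 < gam.
(** [a N n k] is coordinate [k] of the [n]-th vector of the [N]-th ladder. Each ladder lives in its
    own finite sum, and nothing bounds [dim N] as [N] grows. *)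
Variable dim : nat -> nat.
Variables a b : nat -> nat -> nat -> Y.
Hypothesis a_bound : forall N n, rsum (fun k => vnorm (a N n k)) (dim N) <= M.
Hypothesis b_bound : forall N n, rsum (fun k => vnorm (b N n k)) (dim N) <= M.
Hypothesis ab_gap : forall N i j, (i < j < N)%nat ->
  gam <= rsum (fun k => asymmetry (fun n => a N n k) (fun n => b N n k) i j) (dim N).

(** Dominating both vectors, [height] allows one subsequence and one truncation for [a] and [b]
    together. *)
Let height N n k := vnorm (a N n k) + vnorm (b N n k).

Fixpoint max_height (N : nat) (F : list nat) (k : nat) : R :=
  match F with nil => 0 | n :: F => Rmax (height N n k) (max_height N F k) end.

Let mass N F := rsum (max_height N F) (dim N).

Lemma height_pos N n k : 0 <= height N n k.
Proof.
  unfold height. pose proof (vnorm_pos (a N n k)). pose proof (vnorm_pos (b N n k)). lra.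
Qed.

Lemma max_height_pos N F k : 0 <= max_height N F k.
Proof. destruct F; simpl; [lra|]. eapply Rle_trans; [apply height_pos|apply Rmax_l]. Qed.

Lemma height_mass N n : rsum (height N n) (dim N) <= 2 * M.
Proof.
  unfold height. rewrite rsum_plus. specialize (a_bound N n). specialize (b_bound N n). lra.
Qed.

Lemma mass_cons N n F : mass N F <= mass N (n :: F) <= mass N F + 2 * M.
Proof.
  unfold mass. split.
  - apply rsum_le. intros k _. apply Rmax_r.
  - eapply Rle_trans; [|apply Rplus_le_compat_l, (height_mass N n)].
    rewrite <- rsum_plus. apply rsum_le. intros k _. simpl.
    pose proof (height_pos N n k). pose proof (max_height_pos N F k).
    apply Rmax_lub; lra.
Qed.

Lemma mass_bound N F : 0 <= mass N F <= INR (length F) * (2 * M).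
Proof.
  induction F as [|n F IH].
  - change (mass N nil) with (rsum (fun _ => 0) (dim N)). rewrite rsum_zero. simpl. lra.
  - pose proof (mass_cons N n F). cbn [length]. rewrite S_INR. lra.
Qed.

Let excess N F n k := Rmax (height N n k) (max_height N F k) - max_height N F k.

(* Pointwise, the excess of [h'] over [max h H] is the excess of [h'] over [H] minus the common
   part of the excesses of [h] and [h'] over [H]. *)
Lemma common_excess N F n n' :
  rsum (fun k => Rmin (excess N F n k) (excess N F n' k)) (dim N)
  = (mass N (n' :: F) - mass N F) - (mass N (n' :: n :: F) - mass N (n :: F)).
Proof.
  unfold mass. rewrite <- !rsum_minus. apply rsum_ext. intros k _. unfold excess. simpl.
  unfold Rmin, Rmax. repeat destruct (Rle_dec _ _); lra.
Qed.

Lemma limit_mass F : ulim U (fun N => mass N F) (Ulim U (fun N => mass N F)).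
Proof.
  apply (Ulim_spec U _ (INR (length F) * (2 * M)) HU). intros N.
  pose proof (mass_bound N F). apply Rabs_le. lra.
Qed.

(* A finite set [F] nearly minimizing the limit increment of the mass: the excesses over [F] of
   the members of a subsequence [J] are then almost disjoint. *)
Lemma almost_disjoint_excess delta : 0 < delta -> exists F J,
  (forall l l', (l < l')%nat -> (J l < J l')%nat) /\
  forall l l', (l < l')%nat ->
    U (fun N => rsum (fun k => Rmin (excess N F (J l) k) (excess N F (J l') k)) (dim N) <= delta).
Proof.
  intros Hd. set (Mass := fun F => Ulim U (fun N => mass N F)).
  assert (HM : forall F, ulim U (fun N => mass N F) (Mass F)) by apply limit_mass.
  assert (Hinc : forall n F, 0 <= Mass (n :: F) - Mass F <= 2 * M).
  { intros n F. pose proof (ulim_minus U HU _ _ _ _ (HM (n :: F)) (HM F)) as H. split.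
    - apply (ulim_ge_const U HU _ _ _ H), (uf_all U HU). intros N.
      pose proof (mass_cons N n F). lra.
    - apply (ulim_le_const U HU _ _ _ H), (uf_all U HU). intros N.
      pose proof (mass_cons N n F). lra. }
  set (incr := fun F => Ulim U (fun n => Mass (n :: F) - Mass F)).
  assert (HI : forall F, ulim U (fun n => Mass (n :: F) - Mass F) (incr F)).
  { intros F. apply (Ulim_spec U _ (2 * M) HU). intros n. specialize (Hinc n F).
    apply Rabs_le. lra. }
  assert (Hinc0 : forall F, 0 <= incr F).
  { intros F. apply (ulim_ge_const U HU _ _ _ (HI F)), (uf_all U HU). intros n. apply Hinc. }
  (* [- c] is the infimum of the limit increments over all finite sets. *)
  destruct (completeness (fun r => exists F, r = - incr F)) as [c [Hc1 Hc2]].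
  { exists 0. intros r [F ->]. specialize (Hinc0 F). lra. }
  { exists (- incr nil), nil. reflexivity. }
  assert (HF : exists F, incr F < - c + delta / 8).
  { apply NNPP. intros Hno. assert (c <= c - delta / 8); [|lra]. apply Hc2.
    intros r [F ->]. apply Rnot_lt_le. intros H. apply Hno. exists F. lra. }
  destruct HF as [F HF]. exists F.
  (* Adding a member of [J] to [F] increases the mass by less than [- c + delta / 8]; adding it
     after an earlier member still increases it by more than [- c - delta / 8]. By [common_excess],
     the common part is below [delta / 4] in the limit. *)
  destruct (sequence_extraction (fun n => Mass (n :: F) - Mass F < - c + delta / 8)
    (fun n n' => (n < n')%nat /\ - c - delta / 8 < Mass (n' :: n :: F) - Mass (n :: F)))
    as [J [HJ1 HJ2]].
  { intros L _. apply (uf_ex U HU). apply (uf_and U HU).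
    - apply (ulim_lt_const U HU _ _ _ (HI F) HF).
    - apply uf_forall_list; [exact HU|]. apply Forall_forall. intros n _.
      apply (uf_and U HU); [now apply uf_gt|].
      apply (ulim_gt_const U HU _ _ _ (HI (n :: F))).
      assert (- incr (n :: F) <= c) by (apply Hc1; now exists (n :: F)). lra. }
  exists J. split; [intros l l' H; now apply HJ2|].
  intros l l' Hl. destruct (HJ2 l l' Hl) as [_ H2]. specialize (HJ1 l').
  pose proof (ulim_minus U HU _ _ _ _
    (ulim_minus U HU _ _ _ _ (HM (J l' :: F)) (HM F))
    (ulim_minus U HU _ _ _ _ (HM (J l' :: J l :: F)) (HM (J l :: F)))) as H.
  apply (uf_mono U HU _ _ (ulim_lt_const U HU _ _ delta H ltac:(lra))).
  intros N HNd. rewrite common_excess. lra.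
Qed.

(** The order of choices matters. [F] yields a bound on the total truncation level that does not
    involve [N]; this fixes the accuracy and with it [d]; only then is [N] taken so large that the
    initial members of [J] lie in the [N]-th ladder and have almost disjoint excesses. After
    truncation at [lam * H k] the bounds for the coordinates add up to [gam / 4 * INR d], while
    every pair keeps an asymmetry of [gam / 2]. *)
Lemma l1_ladders_bounded : False.
Proof.
  assert (HM0 : 0 <= M).
  { eapply Rle_trans; [|apply (a_bound O O)]. apply rsum_pos. intros. apply vnorm_pos. }
  (* Truncation costs [8 * delta] for the common excesses and at most [32 * M / lam] for the
     relative error; each is to stay within [gam / 4]. *)
  set (delta := gam / 32). set (lam := 2 + 128 * M / gam).
  assert (Hlam : 2 <= lam).
  { unfold lam. assert (0 <= 128 * M / gam) by (apply Rdiv_nonneg; lra). lra. }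
  assert (Hlam2 : 32 * M / lam <= gam / 4).
  { apply (Rmult_le_reg_r lam); [lra|].
    replace (32 * M / lam * lam) with (32 * M) by (field; lra).
    unfold lam. replace (gam / 4 * (2 + 128 * M / gam)) with (gam / 2 + 32 * M) by (field; lra).
    lra. }
  destruct (almost_disjoint_excess delta ltac:(unfold delta; lra)) as (F & J & HJ & HJd).
  (* [B] bounds the sum over [k] of the levels [lam * H k] for every [N]; the summand [gam] keeps
     [B] positive and the accuracy [gam / 4 / B] below 1. *)
  set (B := lam * (INR (length F) * (2 * M)) + gam).
  assert (HB : gam <= B).
  { unfold B. pose proof (pos_INR (length F)).
    assert (0 <= INR (length F) * (2 * M)) by (apply Rmult_le_pos; lra). nra. }
  destruct (node_sum_small Y U HY HU HN (gam / 4 / B)) as [d [Hd1 Hd]].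
  { split; [apply Rdiv_lt_0_compat; lra|].
    apply (Rmult_le_reg_r B); [lra|].
    replace (gam / 4 / B * B) with (gam / 4) by (field; lra). lra. }
  destruct (uf_ex U HU _ (uf_and U HU _ _ (uf_gt U HU HN (J (2 ^ d)%nat))
    (uf_forall_lt U HU (fun l' N => forall l, (l < 2 ^ d)%nat -> (l < l')%nat ->
       rsum (fun k => Rmin (excess N F (J l) k) (excess N F (J l') k)) (dim N) <= delta)
      (2 ^ d) ltac:(
    intros l' _; apply (uf_forall_lt U HU (fun l N => (l < l')%nat ->
       rsum (fun k => Rmin (excess N F (J l) k) (excess N F (J l') k)) (dim N) <= delta));
    intros l _; destruct (lt_dec l l') as [Hl|Hl];
      [apply (uf_mono U HU _ _ (HJd l l' Hl)); auto|now apply (uf_all U HU)]))))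
    as [N [HNJ Hdisj]].
  set (H := max_height N F).
  assert (HH : forall k, 0 <= H k) by apply max_height_pos.
  set (x := fun k l => if Rle_dec (height N (J l) k) (lam * H k) then a N (J l) k else vzero).
  set (y := fun k l => if Rle_dec (height N (J l) k) (lam * H k) then b N (J l) k else vzero).
  assert (Hup : forall k, node_sum (asymmetry (x k) (y k)) d 0
      <= gam / 4 / B * (lam * H k) * INR d).
  { intros k. assert (0 <= lam * H k) by (apply Rmult_le_pos; [lra|apply HH]).
    apply Hd; intros l; [unfold x|unfold y]; destruct (Rle_dec _ _) as [Hl|Hl];
      rewrite ?vnorm_zero; try lra; unfold height in Hl;
      pose proof (vnorm_pos (a N (J l) k)); pose proof (vnorm_pos (b N (J l) k)); lra. }
  assert (Hlow : gam / 2 * INR d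
      <= node_sum (fun l l' => rsum (fun k => asymmetry (x k) (y k) l l') (dim N)) d 0).
  { apply node_sum_ge. intros l l' [_ Hl] [_ Hl'] Hll. simpl in Hl, Hl'.
    assert (HJN : (J l < J l' < N)%nat).
    { split; [now apply HJ|]. pose proof (HJ l' (2 ^ d)%nat Hl'). lia. }
    pose proof (ab_gap N _ _ HJN) as Hgap.
    specialize (Hdisj l' Hl' l Hl Hll).
    assert (Herr : rsum (fun k => asymmetry (fun n => a N n k) (fun n => b N n k) (J l) (J l'))
        (dim N) <= rsum (fun k => asymmetry (x k) (y k) l l'
          + (8 / lam * (height N (J l) k + height N (J l') k)
          + 8 * Rmin (excess N F (J l) k) (excess N F (J l') k))) (dim N)).
    { apply rsum_le. intros k _. unfold asymmetry.
      assert (Ha : forall n, vnorm (a N n k) <= height N n k).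
      { intros n. unfold height. pose proof (vnorm_pos (b N n k)). lra. }
      assert (Hb : forall n, vnorm (b N n k) <= height N n k).
      { intros n. unfold height. pose proof (vnorm_pos (a N n k)). lra. }
      pose proof (kernel_truncation (a N (J l) k) (b N (J l') k) _ _ (H k) lam
        (Ha _) (Hb _) (HH k) Hlam) as K1.
      pose proof (kernel_truncation (a N (J l') k) (b N (J l) k) _ _ (H k) lam
        (Ha _) (Hb _) (HH k) Hlam) as K2.
      rewrite Rmin_comm in K2.
      change (Rmax (height N (J l) k) (H k) - H k) with (excess N F (J l) k) in K1, K2.
      change (Rmax (height N (J l') k) (H k) - H k) with (excess N F (J l') k) in K1, K2.
      fold (x k l) (y k l') in K1. fold (x k l') (y k l) in K2.
      apply Rabs_le_inv in K1. apply Rabs_le_inv in K2.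
      replace (8 / lam * (height N (J l) k + height N (J l') k)) with
        (4 * (height N (J l) k + height N (J l') k) / lam
         + 4 * (height N (J l') k + height N (J l) k) / lam) by (field; lra).
      lra. }
    rewrite !rsum_plus, !rsum_scal, rsum_plus in Herr.
    pose proof (height_mass N (J l)). pose proof (height_mass N (J l')).
    set (s := rsum (height N (J l)) (dim N)) in *. set (s' := rsum (height N (J l')) (dim N)) in *.
    assert (8 / lam * (s + s') <= gam / 4).
    { eapply Rle_trans; [|exact Hlam2].
      replace (32 * M / lam) with (8 / lam * (2 * M + 2 * M)) by (field; lra).
      apply Rmult_le_compat_l; [apply Rdiv_nonneg; lra|lra]. }
    unfold delta in Hdisj.
    change (fun i => height N (J l) i) with (height N (J l)) in Herr.
    change (fun i => height N (J l') i) with (height N (J l')) in Herr.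
    fold s s' in Herr. lra. }
  rewrite node_sum_rsum in Hlow.
  assert (Hfin : rsum (fun k => node_sum (asymmetry (x k) (y k)) d 0) (dim N)
    <= gam / 4 * INR d).
  { eapply Rle_trans; [apply rsum_le; intros k _; apply Hup|].
    rewrite (rsum_ext _ (fun k => (gam / 4 / B * lam * INR d) * H k)) by (intros; ring).
    rewrite rsum_scal. change (rsum _ (dim N)) with (mass N F).
    pose proof (mass_bound N F). pose proof (pos_INR d).
    replace (gam / 4 * INR d) with (gam / 4 / B * INR d * B) by (field; lra).
    replace (gam / 4 / B * lam * INR d * mass N F)
      with (gam / 4 / B * INR d * (lam * mass N F)) by ring.
    apply Rmult_le_compat_l.
    - apply Rmult_le_pos; [apply Rdiv_nonneg; lra|lra].
    - unfold B. nra. }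
  assert (1 <= INR d) by (replace 1 with (INR 1) by reflexivity; apply le_INR; lia).
  pose proof (Rle_trans _ _ _ Hlow Hfin). nra.
Qed.

End Ladders.

(** * The space l1(Y) *)

Section L1.
Variable Y : Banach.

Definition summable (a : nat -> Y) : Prop :=
  exists M, forall n, rsum (fun k => vnorm (a k)) n <= M.

Definition l1vec : Type := {a : nat -> Y | summable a}.

Definition coord (x : l1vec) : nat -> Y := proj1_sig x.

Lemma l1vec_eq x y : (forall k, coord x k = coord y k) -> x = y.
Proof.
  destruct x as [a Ha], y as [b Hb]. unfold coord; simpl. intros H.
  apply subset_eq_compat. now apply functional_extensionality.
Qed.

Definition l1norm (x : l1vec) : R.
Proof.
  refine (proj1_sig (completeness (fun r => exists n, r = rsum (fun k => vnorm (coord x k)) n) _ _)).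
  - destruct (proj2_sig x) as [M HM]. exists M. intros r [n ->]. apply HM.
  - exists 0, O. reflexivity.
Defined.

Lemma l1norm_ge x n : rsum (fun k => vnorm (coord x k)) n <= l1norm x.
Proof.
  unfold l1norm. destruct (completeness _ _ _) as [m [Hm Hm']]; simpl. apply Hm. now exists n.
Qed.

Lemma l1norm_le x c : (forall n, rsum (fun k => vnorm (coord x k)) n <= c) -> l1norm x <= c.
Proof.
  intros H. unfold l1norm. destruct (completeness _ _ _) as [m [Hm' Hm]]; simpl.
  apply Hm. intros r [n ->]. apply H.
Qed.

Lemma l1norm_coord x k : vnorm (coord x k) <= l1norm x.
Proof.
  eapply Rle_trans; [|apply (l1norm_ge x (S k))].
  apply (rsum_term (fun k => vnorm (coord x k))); [intros; apply vnorm_pos|lia].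
Qed.

Lemma l1norm_approx x e : 0 < e ->
  exists n, forall m, (n <= m)%nat -> l1norm x - e <= rsum (fun k => vnorm (coord x k)) m.
Proof.
  intros He. apply NNPP. intros Hno. assert (l1norm x <= l1norm x - e); [|lra].
  apply l1norm_le. intros n. apply Rnot_lt_le. intros Hlt. apply Hno. exists n. intros m Hm.
  pose proof (rsum_mono (fun k => vnorm (coord x k)) n m (fun k => vnorm_pos _) Hm). lra.
Qed.

Lemma rsum_vnorm_add (a b : nat -> Y) n : rsum (fun k => vnorm (vadd (a k) (b k))) n
  <= rsum (fun k => vnorm (a k)) n + rsum (fun k => vnorm (b k)) n.
Proof. rewrite <- rsum_plus. apply rsum_le. intros k _. apply vnorm_triangle. Qed.

Lemma summable_add (a b : nat -> Y) :
  summable a -> summable b -> summable (fun k => vadd (a k) (b k)).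
Proof.
  intros [M HM] [N HN]. exists (M + N). intros n.
  pose proof (rsum_vnorm_add a b n). specialize (HM n). specialize (HN n). lra.
Qed.

Lemma summable_scal r (a : nat -> Y) : summable a -> summable (fun k => vscal r (a k)).
Proof.
  intros [M HM]. exists (Rabs r * M). intros n.
  rewrite (rsum_ext _ (fun k => Rabs r * vnorm (a k))) by (intros; apply vnorm_scal).
  rewrite rsum_scal. apply Rmult_le_compat_l; [apply Rabs_pos|apply HM].
Qed.

Lemma summable_opp (a : nat -> Y) : summable a -> summable (fun k => vopp (a k)).
Proof.
  intros [M HM]. exists M. intros n.
  rewrite (rsum_ext _ (fun k => vnorm (a k))) by (intros; apply vnorm_opp). apply HM.
Qed.

Lemma summable_zero : summable (fun _ => vzero).
Proof.
  exists 0. intros n. rewrite (rsum_ext _ (fun _ => 0)) by (intros; apply vnorm_zero).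
  rewrite rsum_zero. lra.
Qed.

Definition l1zero : l1vec := exist _ _ summable_zero.
Definition l1add (x y : l1vec) : l1vec := exist _ _ (summable_add _ _ (proj2_sig x) (proj2_sig y)).
Definition l1opp (x : l1vec) : l1vec := exist _ _ (summable_opp _ (proj2_sig x)).
Definition l1scal r (x : l1vec) : l1vec := exist _ _ (summable_scal r _ (proj2_sig x)).

Ltac l1ext := intros; apply l1vec_eq; intros k; unfold coord; simpl; vec.

Lemma l1add_assoc x y z : l1add x (l1add y z) = l1add (l1add x y) z.
Proof. l1ext. Qed.
Lemma l1add_comm x y : l1add x y = l1add y x.
Proof. l1ext. Qed.
Lemma l1add_0 x : l1add x l1zero = x.
Proof. l1ext. Qed.
Lemma l1add_opp x : l1add x (l1opp x) = l1zero.
Proof. l1ext. Qed.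
Lemma l1scal_1 x : l1scal 1 x = x.
Proof. l1ext. Qed.
Lemma l1scal_assoc a b x : l1scal a (l1scal b x) = l1scal (a * b) x.
Proof. l1ext. Qed.
Lemma l1scal_distr_v a x y : l1scal a (l1add x y) = l1add (l1scal a x) (l1scal a y).
Proof. l1ext. Qed.
Lemma l1scal_distr_s a b x : l1scal (a + b) x = l1add (l1scal a x) (l1scal b x).
Proof. l1ext. Qed.

Lemma l1norm_pos x : 0 <= l1norm x.
Proof. exact (l1norm_ge x 0). Qed.

Lemma l1norm_eq0 x : l1norm x = 0 -> x = l1zero.
Proof.
  intros H. apply l1vec_eq. intros k. apply vnorm_eq0.
  pose proof (l1norm_coord x k). pose proof (vnorm_pos (coord x k)). lra.
Qed.

Lemma l1norm_triangle x y : l1norm (l1add x y) <= l1norm x + l1norm y.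
Proof.
  apply l1norm_le. intros n. pose proof (rsum_vnorm_add (coord x) (coord y) n).
  pose proof (l1norm_ge x n). pose proof (l1norm_ge y n).
  unfold coord in *. simpl in *. lra.
Qed.

Lemma l1norm_scal a x : l1norm (l1scal a x) = Rabs a * l1norm x.
Proof.
  assert (E : forall n, rsum (fun k => vnorm (coord (l1scal a x) k)) n
    = Rabs a * rsum (fun k => vnorm (coord x k)) n).
  { intros n. rewrite <- rsum_scal. apply rsum_ext. intros k _. apply vnorm_scal. }
  apply Rle_antisym.
  - apply l1norm_le. intros n. rewrite E.
    apply Rmult_le_compat_l; [apply Rabs_pos|apply l1norm_ge].
  - destruct (Req_dec a 0) as [->|Ha].
    { rewrite Rabs_R0, Rmult_0_l. apply l1norm_pos. }
    apply Rabs_pos_lt in Ha.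
    apply (Rmult_le_reg_l (/ Rabs a)); [now apply Rinv_0_lt_compat|].
    replace (/ Rabs a * (Rabs a * l1norm x)) with (l1norm x) by (field; lra).
    apply l1norm_le. intros n.
    apply (Rmult_le_reg_l (Rabs a)); [exact Ha|]. rewrite <- E.
    replace (Rabs a * (/ Rabs a * l1norm (l1scal a x))) with (l1norm (l1scal a x))
      by (field; lra). apply l1norm_ge.
Qed.

Lemma l1complete (u : nat -> l1vec) :
  (forall eps, 0 < eps -> exists N, forall m n, (N <= m)%nat -> (N <= n)%nat ->
      l1norm (l1add (u m) (l1opp (u n))) < eps) ->
  exists l, forall eps, 0 < eps -> exists N, forall n, (N <= n)%nat ->
      l1norm (l1add (u n) (l1opp l)) < eps.
Proof.
  intros Hu.
  destruct (choice (fun k l => forall e, 0 < e -> exists N, forall n, (N <= n)%nat ->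
    dist (coord (u n) k) l < e)) as [l Hl].
  { intros k. apply (vcomplete _ (fun n => coord (u n) k)). intros e He.
    destruct (Hu e He) as [N HN]. exists N. intros m n Hm Hn.
    eapply Rle_lt_trans; [|exact (HN m n Hm Hn)].
    exact (l1norm_coord (l1add (u m) (l1opp (u n))) k). }
  assert (Hl' : forall K e, 0 < e -> exists N, forall n, (N <= n)%nat ->
    rsum (fun k => dist (coord (u n) k) (l k)) K <= e).
  { induction K as [|K IH]; intros e He; [exists O; intros; simpl; lra|].
    destruct (IH (e / 2) ltac:(lra)) as [N1 H1]. destruct (Hl K (e / 2) ltac:(lra)) as [N2 H2].
    exists (max N1 N2). intros n Hn. specialize (H1 n ltac:(lia)). specialize (H2 n ltac:(lia)).
    simpl. lra. }
  assert (Hlim : forall e, 0 < e -> exists N, forall m, (N <= m)%nat -> forall K,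
    rsum (fun k => dist (coord (u m) k) (l k)) K <= e).
  { intros e He. destruct (Hu (e / 2) ltac:(lra)) as [N HN]. exists N. intros m Hm K.
    destruct (Hl' K (e / 2) ltac:(lra)) as [N2 H2].
    specialize (HN m (max N N2) Hm (Nat.le_max_l _ _)). specialize (H2 _ (Nat.le_max_r N N2)).
    pose proof (l1norm_ge (l1add (u m) (l1opp (u (max N N2)))) K) as H3.
    apply (Rle_trans _ (rsum (fun k => dist (coord (u m) k) (coord (u (max N N2)) k)
      + dist (coord (u (max N N2)) k) (l k)) K)).
    - apply rsum_le. intros. apply dist_triangle.
    - rewrite rsum_plus.
      change (rsum (fun k => dist (coord (u m) k) (coord (u (max N N2)) k)) K
        <= l1norm (l1add (u m) (l1opp (u (max N N2))))) in H3. lra. }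
  assert (Hs : summable l).
  { destruct (Hlim 1 Rlt_0_1) as [N HN]. specialize (HN N (Nat.le_refl _)).
    exists (l1norm (u N) + 1). intros K. specialize (HN K).
    pose proof (l1norm_ge (u N) K).
    apply (Rle_trans _ (rsum (fun k => vnorm (coord (u N) k) + dist (coord (u N) k) (l k)) K)).
    - apply rsum_le. intros k _. rewrite dist_sym. apply vnorm_le_dist.
    - rewrite rsum_plus. lra. }
  exists (exist _ l Hs). intros e He. destruct (Hlim (e / 2) ltac:(lra)) as [N HN].
  exists N. intros n Hn. apply (Rle_lt_trans _ (e / 2)); [|lra].
  apply l1norm_le. intros K. exact (HN n Hn K).
Qed.

Definition l1 : Banach := {|
  vec := l1vec; vzero := l1zero; vadd := l1add; vopp := l1opp; vscal := l1scal; vnorm := l1norm;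
  vadd_assoc := l1add_assoc; vadd_comm := l1add_comm; vadd_0 := l1add_0; vadd_opp := l1add_opp;
  vscal_1 := l1scal_1; vscal_assoc := l1scal_assoc; vscal_distr_v := l1scal_distr_v;
  vscal_distr_s := l1scal_distr_s; vnorm_eq0 := l1norm_eq0; vnorm_scal := l1norm_scal;
  vnorm_triangle := l1norm_triangle; vcomplete := l1complete |}.

Lemma l1dist_ge (x y : l1) n :
  rsum (fun k => dist (coord x k) (coord y k)) n <= dist x y.
Proof. exact (l1norm_ge (l1add x (l1opp y)) n). Qed.

Lemma l1kernel_approx (x y : l1) e : 0 < e -> exists n, forall m, (n <= m)%nat ->
  Rabs (kernel x y - rsum (fun k => kernel (coord x k) (coord y k)) m) <= e.
Proof.
  intros He. destruct (l1norm_approx x (e / 2) ltac:(lra)) as [n1 H1].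
  destruct (l1norm_approx y (e / 2) ltac:(lra)) as [n2 H2].
  destruct (l1norm_approx (l1add x (l1opp y)) e He) as [n3 H3].
  exists (max n1 (max n2 n3)). intros m Hm.
  specialize (H1 m ltac:(lia)). specialize (H2 m ltac:(lia)). specialize (H3 m ltac:(lia)).
  change (dist x y - e <= rsum (fun k => dist (coord x k) (coord y k)) m) in H3.
  unfold kernel. rewrite !rsum_minus.
  pose proof (l1norm_ge x m). pose proof (l1norm_ge y m). pose proof (l1dist_ge x y m).
  change (@vnorm l1 x) with (l1norm x). change (@vnorm l1 y) with (l1norm y).
  apply Rabs_le. lra.
Qed.

End L1.

(** * Superstability of l1(Y) *)

Lemma fin_rep_dist {Z E : Banach} (z : nat -> Z) (w : nat -> E) n e :
  (forall a, (1 - e) * vnorm (lincomb a z n) <= vnorm (lincomb a w n) /\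
     vnorm (lincomb a w n) <= (1 + e) * vnorm (lincomb a z n)) ->
  (forall i, (i < n)%nat -> Rabs (vnorm (w i) - vnorm (z i)) <= e * vnorm (z i)) /\
  (forall i j, (i < n)%nat -> (j < n)%nat ->
     Rabs (dist (w i) (w j) - dist (z i) (z j)) <= e * dist (z i) (z j)).
Proof.
  intros H. split.
  - intros i Hi. specialize (H (fun k => if Nat.eqb k i then 1 else 0)).
    rewrite !lincomb_single in H by exact Hi. apply Rabs_le. lra.
  - intros i j Hi Hj.
    specialize (H (fun k => (if Nat.eqb k i then 1 else 0) - (if Nat.eqb k j then 1 else 0))).
    rewrite !lincomb_minus, !lincomb_single in H by assumption.
    fold (dist (w i) (w j)) in H. fold (dist (z i) (z j)) in H. apply Rabs_le. lra.
Qed.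

(** The first [N] pairs of the ladder are copied into l1(Y) by finite representability and then cut
    to finitely many coordinates. Half of the gap survives: copying costs [gam / 4], and cutting
    costs [gam / 8] for each of the two kernels. *)
Lemma asymmetry_gap_l1 (Y Z : Banach) U : superstable Y -> ultrafilter U -> nonprincipal U ->
  fin_rep Z (l1 Y) -> forall (a b : nat -> Z) gam M, 0 < gam ->
  (forall i, vnorm (a i) <= M) -> (forall i, vnorm (b i) <= M) ->
  (forall i j, (i < j)%nat -> gam <= asymmetry a b i j) -> False.
Proof.
  intros HY HU HN HZ a b gam M Hg Ha Hb Hgap.
  assert (HM : 0 <= M) by (pose proof (vnorm_pos (a O)); specialize (Ha O); lra).
  (* A kernel changes by at most [4 * M * e], from a distance at most [2 * M] and two norms at most
     [M]; an asymmetry contains two kernels. *)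
  set (e := Rmin 1 (gam / 4 / (8 * M + 1))).
  assert (He : 0 < e) by (apply Rmin_glb_lt; [lra|apply Rdiv_lt_0_compat; lra]).
  assert (He1 : e <= 1) by apply Rmin_l.
  assert (HeM : 8 * M * e <= gam / 4).
  { apply (Rle_trans _ (8 * M * (gam / 4 / (8 * M + 1)))).
    - apply Rmult_le_compat_l; [lra|apply Rmin_r].
    - apply (Rmult_le_reg_r (8 * M + 1)); [lra|].
      replace (8 * M * (gam / 4 / (8 * M + 1)) * (8 * M + 1)) with (8 * M * (gam / 4))
        by (field; lra). nra. }
  assert (Hrep : forall N, exists (s : nat * (nat -> l1 Y) * (nat -> l1 Y)),
    let '(K, A, B) := s in
    (forall i, vnorm (A i) <= 2 * M) /\ (forall i, vnorm (B i) <= 2 * M) /\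
    forall i j, (i < j < N)%nat -> gam / 2 <=
      rsum (fun k => asymmetry (fun n => coord Y (A n) k) (fun n => coord Y (B n) k) i j) K).
  { intros N.
    (* [fin_rep] takes a single sequence, so [a] and [b] are interleaved as its even and odd
       terms. *)
    pose (z := fun i => if Nat.even i then a (Nat.div2 i) else b (Nat.div2 i)).
    assert (Ez : forall i, z (2 * i)%nat = a i).
    { intros i. unfold z. now rewrite Nat.even_mul, Nat.div2_double. }
    assert (Ez' : forall i, z (S (2 * i)) = b i).
    { intros i. unfold z. now rewrite Nat.even_succ, Nat.odd_mul, Nat.div2_succ_double. }
    destruct (HZ (2 * N)%nat z e He) as [w Hw].
    apply fin_rep_dist in Hw. destruct Hw as [Hw1 Hw2].
    (* Nothing is known about [w] beyond the represented range, whereas the norm bound is required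
       at all indices. *)
    set (A := fun i => if Nat.ltb i N then w (2 * i)%nat else vzero).
    set (B := fun i => if Nat.ltb i N then w (S (2 * i)) else vzero).
    assert (Hcut : forall (c : nat -> Z) i v, (forall i, vnorm (c i) <= M) ->
      ((i < N)%nat -> Rabs (vnorm v - vnorm (c i)) <= e * vnorm (c i)) ->
      vnorm (if Nat.ltb i N then v else (vzero : l1 Y)) <= 2 * M).
    { intros c i v Hc Hv. destruct (Nat.ltb_spec i N) as [Hi|Hi].
      - specialize (Hv Hi). apply Rabs_le_inv in Hv. specialize (Hc i).
        pose proof (vnorm_pos (c i)). nra.
      - rewrite vnorm_zero. lra. }
    assert (HK : forall i, (i < N)%nat -> U (fun K => forall j, (j < N)%nat ->
      Rabs (kernel (A i) (B j)
        - rsum (fun k => kernel (coord Y (A i) k) (coord Y (B j) k)) K) <= gam / 8)).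
    { intros i _. apply (uf_forall_lt U HU (fun j K => Rabs (kernel (A i) (B j)
        - rsum (fun k => kernel (coord Y (A i) k) (coord Y (B j) k)) K) <= gam / 8)).
      intros j _. destruct (l1kernel_approx Y (A i) (B j) (gam / 8) ltac:(lra)) as [n Hn].
      apply (uf_mono U HU _ _ (uf_gt U HU HN n)). intros K HK. apply Hn. lia. }
    destruct (uf_ex U HU _ (uf_forall_lt U HU _ N HK)) as [K HKN].
    exists (K, A, B). split; [|split].
    - intros i. apply (Hcut a i); [exact Ha|]. intros Hi. rewrite <- Ez. apply Hw1. lia.
    - intros i. apply (Hcut b i); [exact Hb|]. intros Hi. rewrite <- Ez'. apply Hw1. lia.
    - intros i j Hij. unfold asymmetry. rewrite rsum_minus.
      pose proof (Rabs_le_inv _ _ (HKN i ltac:(lia) j ltac:(lia))) as K1.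
      pose proof (Rabs_le_inv _ _ (HKN j ltac:(lia) i ltac:(lia))) as K2.
      specialize (Hgap i j (proj1 Hij)). unfold asymmetry in Hgap.
      assert (HAB : forall p q, (p < N)%nat -> (q < N)%nat ->
        Rabs (kernel (A p) (B q) - kernel (a p) (b q)) <= 4 * M * e).
      { intros p q Hp Hq. unfold kernel, A, B.
        destruct (Nat.ltb_spec p N); [|lia]. destruct (Nat.ltb_spec q N); [|lia].
        pose proof (Hw1 (2 * p)%nat ltac:(lia)) as W1.
        pose proof (Hw1 (S (2 * q)) ltac:(lia)) as W2.
        pose proof (Hw2 (2 * p)%nat (S (2 * q)) ltac:(lia) ltac:(lia)) as W3.
        rewrite Ez in W1. rewrite Ez' in W2. rewrite Ez, Ez' in W3.
        apply Rabs_le_inv in W1. apply Rabs_le_inv in W2. apply Rabs_le_inv in W3.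
        pose proof (dist_le_norms (a p) (b q)).
        specialize (Ha p). specialize (Hb q).
        assert (e * vnorm (a p) <= e * M) by (apply Rmult_le_compat_l; lra).
        assert (e * vnorm (b q) <= e * M) by (apply Rmult_le_compat_l; lra).
        assert (e * dist (a p) (b q) <= e * (2 * M)) by (apply Rmult_le_compat_l; lra).
        apply Rabs_le. lra. }
      pose proof (Rabs_le_inv _ _ (HAB i j ltac:(lia) ltac:(lia))).
      pose proof (Rabs_le_inv _ _ (HAB j i ltac:(lia) ltac:(lia))). lra. }
  apply choice in Hrep. destruct Hrep as [s Hs].
  apply (l1_ladders_bounded Y U HY HU HN (gam / 2) (2 * M) ltac:(lra) (fun N => fst (fst (s N)))
    (fun N n k => coord Y (snd (fst (s N)) n) k) (fun N n k => coord Y (snd (s N) n) k)).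
  - intros N n. specialize (Hs N). destruct (s N) as [[K A] B]. simpl.
    eapply Rle_trans; [apply l1norm_ge|apply Hs].
  - intros N n. specialize (Hs N). destruct (s N) as [[K A] B]. simpl.
    eapply Rle_trans; [apply l1norm_ge|apply Hs].
  - intros N i j Hij. specialize (Hs N). destruct (s N) as [[K A] B]. now apply Hs.
Qed.

(** If [L] and [M] differ, a subsequence of pairs is a ladder: the kernel is near [L - p - q] on one
    side of the diagonal and near [M - p - q] on the other. The limits [p] and [q] of the norms
    cancel in the asymmetry. *)
Lemma l1_superstable (Y : Banach) : superstable Y -> superstable (l1 Y).
Proof.
  intros HY Z HZ x y U V Hx Hy HU HUn HV HVn l L m M Hl HL Hm HMm.
  assert (Hconv : forall z : nat -> Z, bounded_seq z ->
    exists B, (forall i, vnorm (z i) <= B) /\ forall W, ultrafilter W ->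
      exists p, ulim W (fun i => vnorm (z i)) p).
  { intros z [B HB]. exists B. split; [exact HB|]. intros W HW.
    apply (ulim_exists W HW _ B). intros i. rewrite Rabs_right; [apply HB|].
    apply Rle_ge, vnorm_pos. }
  destruct (Hconv x Hx) as (Bx & HBx & Hp). destruct (Hp U HU) as [p HpU].
  destruct (Hconv y Hy) as (By & HBy & Hq). destruct (Hq V HV) as [q HqV].
  clear Hconv Hp Hq.
  assert (Hext : forall e, 0 < e -> exists (i j : nat -> nat), forall n k, (n < k)%nat ->
    Rabs (kernel (x (i n)) (y (j k)) - (L - p - q)) <= 4 * e /\
    Rabs (kernel (x (i k)) (y (j n)) - (M - p - q)) <= 4 * e).
  { intros e He.
    (* The terms are pairs of indices because [U] and [V] may differ: the first index is drawn from
       a set in [U], the second from a set in [V]. *)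
    destruct (sequence_extraction
      (fun s : nat * nat => (Rabs (l (fst s) - L) < e /\ Rabs (vnorm (x (fst s)) - p) < e) /\
         (Rabs (m (snd s) - M) < e /\ Rabs (vnorm (y (snd s)) - q) < e))
      (fun s s' => Rabs (dist (x (fst s')) (y (snd s)) - m (snd s)) < e /\
         Rabs (dist (x (fst s)) (y (snd s')) - l (fst s)) < e)) as [s [Hs1 Hs2]].
    - intros S _.
      destruct (uf_ex U HU _ (uf_and U HU _ _ (uf_and U HU _ _ (HL e He) (HpU e He))
        (uf_forall_list U HU (fun s i => Rabs (dist (x i) (y (snd s)) - m (snd s)) < e) S
          (proj2 (Forall_forall _ _) (fun s _ => Hm (snd s) e He))))) as [i [Hi1 Hi2]].
      destruct (uf_ex V HV _ (uf_and V HV _ _ (uf_and V HV _ _ (HMm e He) (HqV e He))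
        (uf_forall_list V HV (fun s j => Rabs (dist (x (fst s)) (y j) - l (fst s)) < e) S
          (proj2 (Forall_forall _ _) (fun s _ => Hl (fst s) e He))))) as [j [Hj1 Hj2]].
      exists (i, j). split; [now split|].
      rewrite Forall_forall in *. intros s Hs. split; [now apply Hi2|now apply Hj2].
    - exists (fun n => fst (s n)), (fun n => snd (s n)). intros n k Hnk.
      destruct (Hs2 n k Hnk) as [H1 H2].
      destruct (Hs1 n) as [[H3 H4] [H5 H6]]. destruct (Hs1 k) as [[_ H7] [_ H8]].
      apply Rabs_def2 in H1, H2, H3, H4, H5, H6, H7, H8.
      unfold kernel. split; apply Rabs_le; lra. }
  set (B := Rmax Bx By).
  assert (HBx' : forall i, vnorm (x i) <= B) by (intros i; eapply Rle_trans; [apply HBx|apply Rmax_l]).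
  assert (HBy' : forall i, vnorm (y i) <= B) by (intros i; eapply Rle_trans; [apply HBy|apply Rmax_r]).
  destruct (Rtotal_order L M) as [H|[H|H]]; [exfalso|exact H|exfalso].
  (* Two kernels, each with error [4 * e], leave half of the gap when [e] is a sixteenth of it.
     Exchanging the roles of [x] and [y] makes the asymmetry positive when [L < M]. *)
  - destruct (Hext ((M - L) / 16) ltac:(lra)) as (i & j & Hij).
    apply (asymmetry_gap_l1 Y Z U HY HU HUn HZ (fun n => y (j n)) (fun n => x (i n))
      ((M - L) / 2) B); [lra|auto|auto|].
    intros n k Hnk. destruct (Hij n k Hnk) as [H1 H2].
    apply Rabs_le_inv in H1. apply Rabs_le_inv in H2.
    unfold asymmetry. rewrite (kernel_sym (y (j n))), (kernel_sym (y (j k))). lra.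
  - destruct (Hext ((L - M) / 16) ltac:(lra)) as (i & j & Hij).
    apply (asymmetry_gap_l1 Y Z U HY HU HUn HZ (fun n => x (i n)) (fun n => y (j n))
      ((L - M) / 2) B); [lra|auto|auto|].
    intros n k Hnk. destruct (Hij n k Hnk) as [H1 H2].
    apply Rabs_le_inv in H1. apply Rabs_le_inv in H2.
    unfold asymmetry. lra.
Qed.

(** * The embedding *)

Lemma rsum_tail f C N n : 0 <= C -> (forall k, 0 <= f k <= C * (1 / 2) ^ k) ->
  rsum f n <= rsum f N + 2 * C * (1 / 2) ^ N.
Proof.
  intros HC Hf. destruct (le_lt_dec n N) as [H|H].
  - pose proof (rsum_mono f n N (fun k => proj1 (Hf k)) H). pose proof (half_pow_pos N). nra.
  - assert (rsum f n <= rsum f N + 2 * C * (1 / 2) ^ N - 2 * C * (1 / 2) ^ n).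
    { induction H as [|n H IH]; simpl.
      - specialize (Hf N). lra.
      - specialize (Hf n). lra. }
    pose proof (half_pow_pos n). nra.
Qed.

(** Origin of the weights in the embedding: the values of [f] at [k]-fold multiples grow at most
    linearly in [k], and [4^-k] turns this into a geometric series. *)
Lemma quarter_pow_INR k : 0 <= (1 / 4) ^ k * INR k <= (1 / 2) ^ k.
Proof.
  assert (H : INR k * (1 / 2) ^ k <= 1).
  { induction k as [|k IH]; [simpl; lra|]. rewrite S_INR. simpl.
    assert ((1 / 2) ^ k <= 1) by (rewrite <- (pow1 k) at 2; apply pow_incr; lra). lra. }
  replace ((1 / 4) ^ k) with ((1 / 2) ^ k * (1 / 2) ^ k)
    by (rewrite <- Rpow_mult_distr; f_equal; lra).
  pose proof (half_pow_pos k). pose proof (pos_INR k).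
  assert (0 <= INR k * (1 / 2) ^ k) by nra. split; nra.
Qed.

Lemma INR_floor r t : 0 < r -> 0 <= t -> exists n, INR n * r <= t < (INR n + 1) * r.
Proof.
  intros Hr Ht. destruct (INR_unbounded (t / r)) as [N HN].
  assert (H : t < INR N * r).
  { apply (Rmult_lt_reg_r (/ r)); [now apply Rinv_0_lt_compat|].
    replace (INR N * r * / r) with (INR N) by (field; lra). exact HN. }
  clear HN. induction N as [|N IH]; [simpl in H; lra|].
  destruct (Rlt_dec t (INR N * r)) as [Hlt|Hge]; [now apply IH|].
  exists N. rewrite S_INR in H. lra.
Qed.

(** The segment from [x] to 0 is cut into pieces shorter than the uniform continuity modulus for 1,
    and each of them moves [f] by less than 1. *)
Lemma unif_cont_growth {X Y : Banach} (f : X -> Y) : unif_cont f ->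
  exists d, 0 < d /\ forall n x, vnorm x <= INR n * d -> dist (f x) (f vzero) <= INR n.
Proof.
  intros Hf. destruct (Hf 1 Rlt_0_1) as (d & Hd & H).
  exists (d / 2). split; [lra|]. induction n as [|n IH]; intros x Hx.
  - simpl in *. rewrite (vnorm_eq0 _ x), dist_refl; [lra|]. pose proof (vnorm_pos x). lra.
  - rewrite S_INR in *. pose proof (pos_INR n) as Hn.
    set (x' := vscal (INR n / (INR n + 1)) x).
    assert (H1 : vnorm x' <= INR n * (d / 2)).
    { unfold x'. rewrite vnorm_scal, Rabs_right by (apply Rle_ge, Rdiv_nonneg; lra).
      apply (Rmult_le_reg_r (INR n + 1)); [lra|].
      replace (INR n / (INR n + 1) * vnorm x * (INR n + 1)) with (INR n * vnorm x)
        by (field; lra). nra. }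
    assert (H2 : dist x x' < d).
    { replace (dist x x') with (vnorm x / (INR n + 1)).
      - apply (Rmult_lt_reg_r (INR n + 1)); [lra|].
        replace (vnorm x / (INR n + 1) * (INR n + 1)) with (vnorm x) by (field; lra). nra.
      - unfold dist, x'.
        replace (vadd x (vopp (vscal (INR n / (INR n + 1)) x))) with (vscal (/ (INR n + 1)) x)
          by (vec_with ltac:(field; lra)).
        rewrite vnorm_scal, Rabs_right by (apply Rle_ge; left; apply Rinv_0_lt_compat; lra).
        unfold Rdiv. ring. }
    pose proof (dist_triangle (f x) (f x') (f vzero)). specialize (IH x' H1).
    specialize (H x x' H2). lra.
Qed.

(* Pushing [y] away from [x] until the distance is exactly [t]. *)
Lemma uncollapsed_near {X Y : Banach} (f : X -> Y) t c d : 0 < t ->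
  (forall x y, dist x y = t -> c <= dist (f x) (f y)) ->
  (forall x y, dist x y < d -> dist (f x) (f y) < c / 2) ->
  forall x y, 0 < dist x y <= t -> t - dist x y < d -> c / 2 <= dist (f x) (f y).
Proof.
  intros Ht Hc Hd x y Hxy Hlt. set (s := dist x y) in *.
  set (y' := vadd x (vscal (t / s) (vadd y (vopp x)))).
  assert (H1 : dist x y' = t).
  { unfold dist, y'.
    replace (vadd x _) with (vscal (t / s) (vadd x (vopp y))) by vec.
    rewrite vnorm_scal. fold (dist x y). fold s.
    rewrite Rabs_right by (apply Rle_ge, Rdiv_nonneg; lra). field. lra. }
  assert (H2 : dist y' y = t - s).
  { unfold dist, y'.
    replace (vadd (vadd x _) _) with (vscal (1 - t / s) (vadd x (vopp y))) by vec.
    rewrite vnorm_scal. fold (dist x y). fold s.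
    rewrite Rabs_minus_sym, Rabs_right; [field; lra|].
    apply Rle_ge. apply (Rmult_le_reg_r s); [lra|].
    replace ((t / s - 1) * s) with (t - s) by (field; lra). lra. }
  pose proof (Hc x y' H1). pose proof (Hd y' y ltac:(lra)).
  pose proof (dist_triangle (f x) (f y) (f y')). rewrite (dist_sym (f y) (f y')) in H3. lra.
Qed.

Theorem theorem3p3 (X Y : Banach) (f : X -> Y) :
  superstable Y -> unif_cont f -> almost_uncollapsed f ->
  exists (Z : Banach) (g : X -> Z), superstable Z /\ unif_embeds_ball g.
Proof.
  intros HY Hf (t & Ht & c & Hc & Hunc). exists (l1 Y).
  destruct (Hf (c / 2) ltac:(lra)) as (d & Hd & Hfd).
  (* Points of the ball have distance [s <= 2], so the multiples of [r * s] advance by at most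
     [d / 2] and [t / 2]: one of them, with a nonzero factor, lies below [t] and within [d] of
     it. *)
  set (r := Rmin t d / 4).
  assert (Hr : 0 < r) by (unfold r; pose proof (Rmin_glb_lt t d 0 Ht Hd); lra).
  assert (Hrt : 4 * r <= t) by (unfold r; pose proof (Rmin_l t d); lra).
  assert (Hrd : 4 * r <= d) by (unfold r; pose proof (Rmin_r t d); lra).
  destruct (unif_cont_growth f Hf) as (d0 & Hd0 & Hgrow).
  assert (Hnorm : forall k (x : X), vnorm (vscal (INR k * r) x) = INR k * (r * vnorm x)).
  { intros k x. rewrite vnorm_scal, Rabs_right; [ring|].
    apply Rle_ge, Rmult_le_pos; [apply pos_INR|lra]. }
  assert (Hdist : forall k (x y : X), dist (vscal (INR k * r) x) (vscal (INR k * r) y)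
      = INR k * r * dist x y).
  { intros k x y. rewrite dist_scal, Rabs_right; [ring|].
    apply Rle_ge, Rmult_le_pos; [apply pos_INR|lra]. }
  set (G := fun (x : X) k => vscal ((1 / 4) ^ k) (vadd (f (vscal (INR k * r) x)) (vopp (f vzero)))).
  assert (Hq : forall k, 0 < (1 / 4) ^ k) by (intros k; apply pow_lt; lra).
  assert (HG : forall m x k, r * vnorm x <= INR m * d0 -> vnorm (G x k) <= INR m * (1 / 2) ^ k).
  { intros m x k Hm. unfold G. rewrite vnorm_scal, Rabs_right by (apply Rle_ge; left; apply Hq).
    specialize (Hgrow (k * m)%nat (vscal (INR k * r) x)).
    rewrite Hnorm, mult_INR in Hgrow.
    pose proof (pos_INR k). pose proof (pos_INR m).
    specialize (Hgrow ltac:(rewrite Rmult_assoc; now apply Rmult_le_compat_l)).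
    unfold dist in Hgrow. pose proof (quarter_pow_INR k).
    apply (Rle_trans _ ((1 / 4) ^ k * (INR k * INR m))).
    - apply Rmult_le_compat_l; [left; apply Hq|exact Hgrow].
    - rewrite <- Rmult_assoc, (Rmult_comm (INR m)). apply Rmult_le_compat_r; lra. }
  assert (Hm : forall x : X, exists m, r * vnorm x <= INR m * d0).
  { intros x. destruct (INR_unbounded (r * vnorm x / d0)) as [m Hm]. exists m.
    apply (Rmult_le_reg_r (/ d0)); [now apply Rinv_0_lt_compat|].
    replace (INR m * d0 * / d0) with (INR m) by (field; lra). left. exact Hm. }
  assert (HS : forall x, summable Y (G x)).
  { intros x. destruct (Hm x) as [m Hmx]. exists (0 + 2 * INR m * (1 / 2) ^ 0). intros n.
    apply (rsum_tail (fun k => vnorm (G x k)) (INR m) 0 n (pos_INR m)).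
    intros k. split; [apply vnorm_pos|now apply HG]. }
  exists (fun x => exist _ (G x) (HS x) : l1 Y).
  assert (HGd : forall x y k, dist (G x k) (G y k)
      = (1 / 4) ^ k * dist (f (vscal (INR k * r) x)) (f (vscal (INR k * r) y))).
  { intros x y k. unfold G. rewrite dist_scal, Rabs_right by (apply Rle_ge; left; apply Hq).
    f_equal. unfold dist. f_equal. vec. }
  assert (Hinv : forall e, 0 < e -> exists e', 0 < e' /\ forall x y, in_ball x -> in_ball y ->
      @dist (l1 Y) (exist _ (G x) (HS x)) (exist _ (G y) (HS y)) < e' -> dist x y < e).
  (* For [s >= e] the detecting coordinate is at most [t / (r * e)], hence at most [N], and its
     weight is at least [4^-N]. *)
  { intros e He. destruct (INR_unbounded (t / (r * e))) as [N HN].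
    exists ((1 / 4) ^ N * (c / 2)). split; [apply Rmult_lt_0_compat; [apply Hq|lra]|].
    intros x y Hx Hy Hlt. apply Rnot_le_lt. intros Hes. apply (Rlt_not_le _ _ Hlt).
    set (s := dist x y) in *.
    assert (Hs2 : s <= 2).
    { unfold s. pose proof (dist_le_norms x y). unfold in_ball in *. lra. }
    destruct (INR_floor (r * s) t ltac:(nra) ltac:(lra)) as [n [Hn1 Hn2]].
    assert (HnN : (n <= N)%nat).
    { apply INR_le. left. eapply Rle_lt_trans; [|exact HN].
      apply (Rmult_le_reg_r (r * e)); [nra|].
      replace (t / (r * e) * (r * e)) with t by (field; nra).
      assert (r * e <= r * s) by (apply Rmult_le_compat_l; lra).
      pose proof (pos_INR n).
      assert (INR n * (r * e) <= INR n * (r * s)) by (now apply Rmult_le_compat_l). lra. }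
    assert (Hrs : r * s <= 2 * r) by nra.
    pose proof (uncollapsed_near f t c d Ht Hunc Hfd (vscal (INR n * r) x) (vscal (INR n * r) y))
      as Hlow.
    rewrite Hdist in Hlow. fold s in Hlow.
    specialize (Hlow ltac:(split; lra) ltac:(lra)).
    eapply Rle_trans; [|apply (l1norm_coord Y _ n)].
    change (vnorm _) with (dist (G x n) (G y n)). rewrite HGd.
    apply Rmult_le_compat; [left; apply Hq|lra| |exact Hlow].
    replace N with (n + (N - n))%nat by lia. rewrite pow_add.
    assert ((1 / 4) ^ (N - n) <= 1) by (rewrite <- (pow1 (N - n)) at 2; apply pow_incr; lra).
    specialize (Hq n). nra. }
  split; [now apply l1_superstable|]. split; [|split; [|exact Hinv]].
  - intros x y Hx Hy Heq. apply dist_eq0, Rle_antisym; [|apply dist_pos].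
    apply Rnot_lt_le. intros Hpos. destruct (Hinv _ Hpos) as (e' & He' & H).
    specialize (H x y Hx Hy). rewrite Heq, dist_refl in H. specialize (H He'). lra.
  - intros e He.
    destruct (INR_unbounded (r / d0)) as [m Hmr].
    assert (Hball : forall x : X, in_ball x -> r * vnorm x <= INR m * d0).
    { intros x Hx. unfold in_ball in Hx.
      assert (r <= INR m * d0).
      { apply (Rmult_le_reg_r (/ d0)); [now apply Rinv_0_lt_compat|].
        replace (INR m * d0 * / d0) with (INR m) by (field; lra). left. exact Hmr. }
      nra. }
    pose proof (pos_INR m) as Hm0.
    set (C := 2 * INR m).
    destruct (half_pow_small (e / 4 / (2 * C + 1))) as [N HN].
    { apply Rdiv_lt_0_compat; unfold C; lra. }
    specialize (HN N (Nat.le_refl _)).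
    assert (HNC : 2 * C * (1 / 2) ^ N <= e / 4).
    { assert (HC : 0 < 2 * C + 1) by (unfold C; lra).
      apply Rmult_lt_compat_r with (r := 2 * C + 1) in HN; [|exact HC].
      replace (e / 4 / (2 * C + 1) * (2 * C + 1)) with (e / 4) in HN by (field; lra).
      pose proof (half_pow_pos N). lra. }
    (* In the first [N] coordinates the values of [f] differ by less than [e / 8], and weights of
       total at most 2 make this [e / 4]; the tail contributes the other [e / 4]. *)
    destruct (Hf (e / 8) ltac:(lra)) as (d1 & Hd1 & Hf1).
    pose proof (pos_INR N) as HN0.
    exists (d1 / ((INR N + 1) * r)). split; [apply Rdiv_lt_0_compat; nra|].
    intros x y Hx Hy Hxy.
    assert (Hxy' : (INR N + 1) * r * dist x y < d1).
    { apply Rmult_lt_compat_l with (r := (INR N + 1) * r) in Hxy; [|nra].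
      replace ((INR N + 1) * r * (d1 / ((INR N + 1) * r))) with d1 in Hxy by (field; nra).
      exact Hxy. }
    apply (Rle_lt_trans _ (e / 2)); [|lra]. apply l1norm_le. intros n.
    change (rsum (fun k => dist (G x k) (G y k)) n <= e / 2).
    eapply Rle_trans; [apply (rsum_tail _ C N); [unfold C; lra|]|].
    { intros k. split; [apply dist_pos|]. eapply Rle_trans; [apply dist_le_norms|].
      pose proof (HG m x k (Hball x Hx)). pose proof (HG m y k (Hball y Hy)). unfold C. lra. }
    assert (rsum (fun k => dist (G x k) (G y k)) N <= rsum (fun k => (1 / 2) ^ k * (e / 8)) N).
    { apply rsum_le. intros k Hk. rewrite HGd.
      apply Rmult_le_compat; [left; apply Hq|apply dist_pos|apply pow_incr; lra|].
      left. apply Hf1. rewrite Hdist. eapply Rle_lt_trans; [|exact Hxy'].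
      assert (INR k <= INR N + 1) by (apply lt_INR in Hk; lra).
      pose proof (dist_pos x y).
      apply Rmult_le_compat_r; [lra|]. apply Rmult_le_compat_r; lra. }
    assert (rsum (fun k => (1 / 2) ^ k * (e / 8)) N <= 0 + 2 * (e / 8) * (1 / 2) ^ 0).
    { apply (rsum_tail _ (e / 8) 0 N); [lra|]. intros k. pose proof (half_pow_pos k).
      split; nra. }
    simpl in *. lra.
Qed.
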